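(* Let $x=Q(x)$ be a quadratic MPS in $n$ variables with least fixed point $q^*>0$, and let $c'_{\min}$ be the least positive coefficient (or constant) of any monomial in $Q(x)$. Let $u=\max\{0,\lceil\log q^*_{\max}\rceil\}$, let $d$ be the maximum depth of SCCs in the DAG $H_Q$ of SCCs of the dependency graph of $x=Q(x)$, let $f$ be its nonlinear depth, and let $\alpha'=2^{-2u}\min\{1,c'_{\min}\}\min\{1,\frac12 q^*_{\min}\}$. For $\epsilon'>0$ set $$g'=2+\left\lceil 2^f\cdot\Big(\log\frac1{\epsilon'}+d\cdot\big(2u+\log(\alpha'^{-(4n+1)})+\log(16n)+\log\|Q(\mathbf{1})\|_\infty\big)\Big)\right\rceil$$ and $h'=g'+1-u$. Then the rounded-down decomposed Newton's method with rounding parameter $h'$, using $g'$ iterations per nonlinear SCC and one iteration per linear SCC, gives an approximation $\tilde q$ with $\|q^*-\tilde q\|_\infty\le\epsilon'$.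
   Context: An MPS is a system $x=Q(x)$ with polynomials having nonnegative coefficients and constant terms; quadratic means degree at most 2; its least fixed point (LFP) $q^*$ is the coordinatewise least nonnegative solution; $q^*_{\min},q^*_{\max}$ are its minimum and maximum coordinates. Dependency graph: nodes are variables, edge $x_i\to x_j$ iff $x_j$ appears in a monomial of $Q_i$ with positive coefficient; $H_Q$ is the DAG of its strongly connected components (SCCs). For an SCC $S$, $D(S)$ is the set of variables outside $S$ reachable from $S$; its equations are $x_S=Q_S(x_S,x_{D(S)})$; $S$ is linear if $x_S=Q_S(x_S,q^*_{D(S)})$ is of degree $\le1$ in $x_S$, else nonlinear. Depth $d$: max over paths of $H_Q$ of the number of SCCs on the path; nonlinear depth $f$: max over paths of the number of nonlinear SCCs. Newton operator $\mathcal{N}(z)=z+(I-B(z))^{-1}(R(z)-z)$ for a system $x=R(x)$ with Jacobian $B$. Rounded-down Newton's method (R-NM) with parameter $h$: $x^{[0]}=\mathbf{0}$, $x^{[k+1]}_i$ = the largest nonnegative integer multiple of $2^{-h}$ that is $\le\max(\mathcal{N}(x^{[k]})_i,0)$. Rounded-down decomposed Newton's method: process SCCs bottom-up; for SCC $S$ with already computed $\tilde q_{D(S)}$, apply to $x_S=Q_S(x_S,\tilde q_{D(S)})$ the given number of R-NM iterations (one if $S$ linear) with the given rounding parameter, yielding $\tilde q_S$. Logarithms base 2. *)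

(* Defs.v *)
From HB Require Import structures.
From mathcomp Require Import all_boot all_order all_algebra.
From mathcomp Require Import mpoly.
From mathcomp Require Import reals.
(* [exp] is not imported: its notations clash with those of [mpoly]. *)
From mathcomp Require exp.

Set Implicit Arguments.
Unset Strict Implicit.
Unset Printing Implicit Defensive.

Import Order.TTheory GRing.Theory Num.Theory.
Local Open Scope ring_scope.

Definition log2 (R : realType) (x : R) : R := exp.ln x / exp.ln 2.

Definition norm_oo (R : realType) (n : nat) (v : 'cV[R]_n) : R :=
  \big[Num.max/0]_(i < n) `|v i 0|.

(* Only used on nonempty sequences; both are 0 on [::]. *)
Definition seq_min (R : realType) (s : seq R) : R :=
  \big[Num.min/head 0 s]_(x <- s) x.
Definition seq_max (R : realType) (s : seq R) : R :=
  \big[Num.max/head 0 s]_(x <- s) x.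

Definition coord_min (R : realType) (n : nat) (v : 'cV[R]_n) : R :=
  seq_min [seq v i 0 | i <- enum 'I_n].
Definition coord_max (R : realType) (n : nat) (v : 'cV[R]_n) : R :=
  seq_max [seq v i 0 | i <- enum 'I_n].

(* The system x = Q(x) is represented by the family of its right-hand sides. *)
Definition system (R : realType) (n : nat) := 'I_n -> {mpoly R[n]}.

Section System.
Variables (R : realType) (n : nat).
Implicit Types (Q : system R n) (z q : 'cV[R]_n).

Definition is_mps Q : Prop := forall i (m : 'X_{1..n}), 0 <= (Q i)@_m.

(* [msize] is one more than the total degree. *)
Definition quadratic Q : Prop := forall i, (msize (Q i) <= 3)%N.

Definition eval_sys Q z : 'cV[R]_n := \col_i (Q i).@[fun j => z j 0].

Definition jacobian Q z : 'M[R]_n :=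
  \matrix_(i, j) ((Q i)^`M(j)).@[fun k => z k 0].

Definition is_lfp Q q : Prop :=
  [/\ forall i, 0 <= q i 0,
      eval_sys Q q = q
    & forall p : 'cV[R]_n, (forall i, 0 <= p i 0) -> eval_sys Q p = p ->
        forall i, q i 0 <= p i 0].

Definition positive_coefs Q : seq R :=
  [seq c <- [seq (Q i)@_m | i <- enum 'I_n, m <- msupp (Q i)] | 0 < c].

Definition least_coef Q : R := seq_min (positive_coefs Q).

(* [None] when I - B(z) is singular, i.e. when the Newton operator is undefined
   at z. *)
Definition newton Q z : option 'cV[R]_n :=
  let A := 1%:M - jacobian Q z in
  if A \in unitmx then Some (z + invmx A *m (eval_sys Q z - z)) else None.

(* The largest nonnegative integer multiple of 2^-h below max(x, 0). *)
Definition round_down (h : int) (x : R) : R :=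
  (Num.floor (Num.max x 0 * 2 ^ h))%:~R * 2 ^ (- h).

Definition rnm_step (h : int) Q z : option 'cV[R]_n :=
  omap (map_mx (round_down h)) (newton Q z).

Definition rnm (h : int) (k : nat) Q : option 'cV[R]_n :=
  iter k (obind (rnm_step h Q)) (Some 0).

End System.

Section Decomposition.
Variables (R : realType) (n : nat) (Q : system R n).
Implicit Types (S T : {set 'I_n}) (q z : 'cV[R]_n).

Definition dep : rel 'I_n := fun i j =>
  has (fun m : 'X_{1..n} => (0 < (Q i)@_m) && (0 < m j)%N) (msupp (Q i)).

Definition scc (i : 'I_n) : {set 'I_n} :=
  [set j | connect dep i j && connect dep j i].

Definition sccs : {set {set 'I_n}} := [set scc i | i : 'I_n].

Definition scc_edge : rel {set 'I_n} := fun S T =>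
  (S != T) && [exists i in S, exists j in T, dep i j].

Definition scc_path (p : seq {set 'I_n}) : bool :=
  all (mem sccs) p && sorted scc_edge p.

(* A path of the DAG repeats no SCC, so it has at most n nodes. *)
Definition max_count_on_paths (w : pred {set 'I_n}) : nat :=
  \max_(k < n.+1) \max_(p : k.-tuple {set 'I_n} | scc_path p) count w p.

(* x_S = Q_S(x_S, z_{D(S)}) as a system in #|S| variables: the variables in S
   are renumbered by the enumeration of S and every other variable is replaced
   by its value in z.  The variables occurring in Q_S lie in S or in D(S). *)
Definition scc_system S z : system R #|S| := fun k =>
  Q (enum_val k) \mPo
    [tuple if [pick l : 'I_#|S| | enum_val l == i] is Some l
           then 'X_l else (z i 0)%:MP | i < n].

#[global] Arguments scc_system S z k : clear implicits.

Definition linear_scc q S : bool :=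
  [forall k : 'I_#|S|, (msize (scc_system S q k) <= 2)%N].

Definition depth : nat := max_count_on_paths predT.

Definition nonlinear_depth q : nat :=
  max_count_on_paths (fun S => ~~ linear_scc q S).

Definition bottom_up (ss : seq {set 'I_n}) : bool :=
  perm_eq ss (enum sccs) && pairwise (fun S T => ~~ scc_edge S T) ss.

Lemma bottom_up_exists : exists ss, bottom_up ss.
Proof.
pose reach (S : {set 'I_n}) := [set j | [exists i in S, connect dep i j]].
have reach_scc i j : (j \in reach (scc i)) = connect dep i j.
  rewrite inE; apply/existsP/idP => [[k /andP[]]|ij].
    by rewrite inE => /andP[ik _]; apply: connect_trans.
  by exists i; rewrite inE connect0.
pose le S T := (#|reach S| <= #|reach T|)%N.
have le_tr : transitive le by move=> S T U; apply: leq_trans.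
have le_tot : total le by move=> S T; apply: leq_total.
exists (sort le (enum sccs)); rewrite /bottom_up perm_sort perm_refl /=.
have: pairwise le (sort le (enum sccs)).
  by rewrite -sorted_pairwise //; apply: sort_sorted.
have: all (mem sccs) (sort le (enum sccs)).
  by apply/allP => S; rewrite mem_sort mem_enum.
apply: sub_in_pairwise => _ _ /imsetP[i _ ->] /imsetP[j _ ->].
rewrite /le leqNgt; apply: contra => /andP[ne_ij].
case/existsP=> a /andP[+ /existsP[b /andP[+ ab]]].
rewrite !inE => /andP[ia ai] /andP[jb bj].
have ij : connect dep i j.
  by apply: connect_trans ia (connect_trans (connect1 ab) bj).
apply: proper_card; apply/properP; split.
  by apply/subsetP => k; rewrite !reach_scc; apply: connect_trans.
exists i; rewrite reach_scc ?connect0 //.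
apply: contraNN ne_ij => ji; apply/eqP/setP => k; rewrite !inE.
apply/andP/andP => -[h1 h2]; split; do ?[exact: connect_trans ji h1
  | exact: connect_trans ij h1 | exact: connect_trans h2 ij
  | exact: connect_trans h2 ji].
Qed.

Definition update S z (y : 'cV[R]_#|S|) : 'cV[R]_n :=
  \col_i if [pick l : 'I_#|S| | enum_val l == i] is Some l
         then y l 0 else z i 0.

Definition process_scc q (h : int) (g : nat) z S : option 'cV[R]_n :=
  omap (update z) (rnm h (if linear_scc q S then 1%N else g) (scc_system S z)).

(* q only serves to decide which SCCs are linear.  The coordinates of the
   initial vector are overwritten before they are used. *)
Definition rdnm q (h : int) (g : nat) (ss : seq {set 'I_n}) :
    option 'cV[R]_n :=
  foldl (fun oz S => obind (fun z => process_scc q h g z S) oz) (Some 0) ss.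

End Decomposition.

Arguments scc_system {R n} Q S z k.

Section Bounds.
Variables (R : realType) (n : nat) (Q : system R n) (q : 'cV[R]_n).

Definition u_param : int := Num.max 0 (Num.ceil (log2 (coord_max q))).

Definition alpha_param : R :=
  2 ^ (- (2 * u_param)) * Num.min 1 (least_coef Q)
    * Num.min 1 (2^-1 * coord_min q).

Definition g_param (eps : R) : int :=
  2 + Num.ceil (2 ^+ nonlinear_depth Q q *
    (log2 (1 / eps) + (depth Q)%:R *
      (2 * u_param%:~R + log2 (alpha_param ^- (4 * n + 1)) + log2 (16 * n%:R)
        + log2 (norm_oo (eval_sys Q (const_mx 1)))))).

Definition h_param (eps : R) : int := g_param eps + 1 - u_param.

(* A value of g below 0, possible for large eps, stands for no iteration. *)
Definition g_iter (eps : R) : nat := absz (Num.max 0 (g_param eps)).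

End Bounds.

(* Main.v *)
Require Import Defs.
From HB Require Import structures.
From mathcomp Require Import all_boot all_order all_algebra.
From mathcomp Require Import mpoly.
From mathcomp Require Import reals.
From mathcomp Require exp.
From mathcomp Require Import ring lra.

Set Implicit Arguments.
Unset Strict Implicit.
Unset Printing Implicit Defensive.

Import Order.TTheory GRing.Theory Num.Theory.
Local Open Scope ring_scope.

(**
  Each SCC is a quadratic map F(x) = c + L x + H(x, x) / 2, and replacing the
  exact values q_D below it by computed lower bounds only decreases c and L.
  Leastness of q forces the Jacobian M = J(q) of the exact map to be
  subcritical: if 0 <> a >= 0 and a <= t M a with t < 1, then q - e a would be a
  prefixed point for small e > 0.  As M is irreducible, there are positive
  vectors v and u with M v <= v and u M <= u.

  The right vector v controls Newton's method: if q' <= q is a fixed point of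
  the perturbed map and q' - x <= l v, one step from x leaves an error of at
  most (l / 2) v, plus the rounding.  The left vector u controls q - q': testing
  w = q - q' against u gives u H(w, w) / 2 <= u D, where D is the defect of q in
  the perturbed map.  By irreducibility the entries of u, v and w differ by
  factors at most alpha^-n, so w is of the order of the square root of the error
  below a nonlinear SCC, and linear in it for a linear SCC.  Along a path of
  SCCs this yields the bound K^d (2^-g)^(1/2^f).
*)

(** * Inverse-positive matrices *)

(** Two obstacles shape the proof. At [q] an SCC may be critical, as for x = 1/2 + x^2/2, so I - M
    itself may be singular and only M v <= v, never a strict inequality, is available. Strictness is
    recovered separately: in a nonlinear SCC from iterates that stay strictly below [q] in every
    coordinate, in a linear one from a positive constant term. Secondly, computed values below an
    SCC may be rounded to 0, so perturbed Jacobians can lose edges. Entries are therefore compared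
    through the exact M, or through a midpoint Jacobian when the error below is at most [mu] =
    min(1, q_min/2), for then values stay above [mu]. A larger error makes the claimed bound
    trivial, because U <= K mu for U = 2^u. The constants: log K is the bracket that g' multiplies
    by d. A square root per nonlinear SCC costs nothing extra in K, since sqrt(K e) <= K sqrt(e) for
    K >= 1. Finally g' is chosen for K^d (2^-g)^(1/2^f) <= eps, and h' makes the rounding unit U
    2^-g / 2, so that the accumulated rounding equals what g halvings leave of U. *)

Section Graph.
Variables (R : realFieldType) (T : finType) (e : rel T).

Lemma connect_invariant (P : T -> Prop) x y :
  (forall a b, e a b -> P a -> P b) -> connect e x y -> P x -> P y.
Proof.
move=> eP /connectP[p + ->]; elim: p x => [|z p IHp] x //= /andP[xz zp] Px.
by apply: IHp zp _; apply: eP Px.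
Qed.

(** One factor [b] is lost per edge, and a path without repetition has fewer than [#|T|] edges;
    [b <= 1] pads the exponent. All later factors [b ^+ m] originate here. *)
Lemma connect_decay (b : R) (f : T -> R) x y :
  0 <= b <= 1 -> (forall a, 0 <= f a) ->
  (forall a c, e a c -> b * f c <= f a) ->
  connect e x y -> b ^+ #|T| * f y <= f x.
Proof.
move=> /andP[b0 b1] f0 ef /connectP[p0 /shortenP[p xp up _] ->] {p0}.
have szp : (size p <= #|T|)%N.
  by apply: leq_trans (leqnSn _) _; rewrite -[X in (X <= _)%N]/(size (x :: p))
     -(card_uniqP up) max_card.
apply: (@le_trans _ _ (b ^+ size p * f (last x p))).
  by apply: ler_wpM2r => //; apply: ler_wiXn2l.
elim: p x xp {up szp} => [|z p IHp] x /=; first by rewrite expr0 mul1r.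
case/andP=> xz zp; rewrite exprS -mulrA; apply: le_trans (ef _ _ xz).
by apply: ler_wpM2l => //; apply: IHp.
Qed.

End Graph.

Definition lemx (R : realType) (m n : nat) (A B : 'M[R]_(m, n)) :=
  forall i j, A i j <= B i j.

(** These are the matrices with nonnegative inverse (monotone matrices). The form without an inverse
    suits minimum-ratio arguments and yields invertibility as a consequence. *)
Definition inverse_positive (R : realType) (m : nat) (A : 'M[R]_m) :=
  forall w : 'cV[R]_m, lemx 0 (A *m w) -> lemx 0 w.

(** As [connect] is reflexive, the 1 by 1 zero matrix counts as irreducible; it belongs to an SCC of
    one variable without a self-loop. *)
Definition irreducible_mx (R : realType) (m : nat) (A : 'M[R]_m) :=
  forall i j, connect [rel a b | 0 < A a b] i j.

Section Entries.
Variables (R : pzRingType) (m n : nat).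
Implicit Types A B : 'M[R]_(m, n).

Lemma zeromx_entry i j : (0 : 'M[R]_(m, n)) i j = 0. Proof. exact: mxE. Qed.
Lemma addmx_entry A B i j : (A + B) i j = A i j + B i j. Proof. exact: mxE. Qed.
Lemma oppmx_entry A i j : (- A) i j = - A i j. Proof. exact: mxE. Qed.
Lemma scalemx_entry (a : R) A i j : (a *: A) i j = a * A i j.
Proof. exact: mxE. Qed.

End Entries.

(* Unlike [mxE], these leave products, Jacobians, etc. folded. *)
Definition entryE := (zeromx_entry, addmx_entry, oppmx_entry, scalemx_entry).

Section Order.
Variable R : realType.

Lemma lemx_refl m n (A : 'M[R]_(m, n)) : lemx A A.
Proof. by move=> i j. Qed.

Lemma lemx_trans m n (B A C : 'M[R]_(m, n)) : lemx A B -> lemx B C -> lemx A C.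
Proof. by move=> AB BC i j; apply: le_trans (BC i j). Qed.

Lemma lemx_mul m n p (A A' : 'M[R]_(m, n)) (B B' : 'M[R]_(n, p)) :
  lemx 0 A -> lemx A A' -> lemx 0 B -> lemx B B' -> lemx (A *m B) (A' *m B').
Proof.
move=> A0 AA B0 BB i j; rewrite !mxE; apply: ler_sum => k _.
by apply: ler_pM; rewrite ?AA ?BB //; have := A0 i k; have := B0 k j; rewrite !mxE.
Qed.

Lemma lemx_mul0 m n p (A : 'M[R]_(m, n)) (B : 'M[R]_(n, p)) :
  lemx 0 A -> lemx 0 B -> lemx 0 (A *m B).
Proof.
move=> A0 B0 i j; rewrite !mxE; apply: sumr_ge0 => k _.
by apply: mulr_ge0; [have := A0 i k|have := B0 k j]; rewrite mxE.
Qed.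

Lemma mulmx1BE m n (A : 'M[R]_m) (w : 'M[R]_(m, n)) :
  (1%:M - A) *m w = w - A *m w.
Proof. by rewrite mulmxBl mul1mx. Qed.

(** A kernel vector and its negative are both nonnegative, hence zero. *)
Lemma inverse_positive_unit m (A : 'M[R]_m) :
  inverse_positive A -> A \in unitmx.
Proof.
move=> posA; rewrite -unitmx_tr -row_free_unit; apply: inj_row_free => v vA.
have Av : A *m v^T = 0 by rewrite -[A]trmxK -trmx_mul vA trmx0.
have vge := posA v^T; have vle := posA (- v^T).
apply/rowP => j; apply/eqP; rewrite mxE eq_le; apply/andP; split.
  have := vle _ j 0; rewrite !mxE oppr_ge0; apply.
  by rewrite mulmxN Av oppr0 => ? ?; rewrite mxE.
by have := vge _ j 0; rewrite !mxE; apply; rewrite Av => ? ?; rewrite mxE.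
Qed.

Lemma inverse_positive_invmx m (A : 'M[R]_m) :
  inverse_positive A -> lemx 0 (invmx A).
Proof.
move=> posA i j; have := posA (col j (invmx A)) _ i 0; rewrite !mxE; apply.
move=> a b; rewrite colE mulmxA mulmxV ?inverse_positive_unit // mul1mx !mxE.
exact: ler0n.
Qed.

Lemma inverse_positive_tr m (A : 'M[R]_m) :
  inverse_positive A -> inverse_positive A^T.
Proof.
move=> posA w Aw; have uA := inverse_positive_unit posA.
have -> : w = (invmx A)^T *m (A^T *m w).
  by rewrite mulmxA -trmx_mul mulmxV // trmx1 mul1mx.
apply: lemx_mul0 => // i j; rewrite !mxE.
by have := inverse_positive_invmx posA j i; rewrite mxE.
Qed.

Lemma inverse_positive_mono m (A : 'M[R]_m) (w w' : 'cV[R]_m) :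
  inverse_positive A -> lemx (A *m w) (A *m w') -> lemx w w'.
Proof.
move=> posA le i j; rewrite -subr_ge0; have := posA (w' - w) _ i j.
rewrite !mxE; apply=> a b; rewrite mulmxBr !mxE subr_ge0.
by have := le a b; rewrite !mxE.
Qed.

(* The indices where w / v is minimal are closed under the edges of M, so they
   would include the strict row k. *)
Lemma inverse_positive_sub1 m (A M : 'M[R]_m) (v : 'cV[R]_m) k :
  lemx 0 A -> lemx A M -> irreducible_mx M -> (forall i, 0 < v i 0) ->
  lemx (M *m v) v -> (A *m v) k 0 < v k 0 -> inverse_positive (1%:M - A).
Proof.
move=> A0 AM irM v0 Mv Avk w; rewrite mulmx1BE => wA i0 j0; rewrite mxE (ord1 j0).
rewrite leNgt; apply/negP => wi0.
pose i1 := [arg min_(i < i0) (w i 0 / v i 0)]%O.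
have i1min : forall j, w i1 0 / v i1 0 <= w j 0 / v j 0.
  by rewrite /i1; case: arg_minP => //= i _ H j; apply: H.
set t := - (w i1 0 / v i1 0).
have t0 : 0 < t.
  rewrite oppr_gt0; apply: le_lt_trans (i1min i0) _.
  by rewrite pmulr_llt0 ?invr_gt0.
have wt j : 0 <= w j 0 + t * v j 0.
  by rewrite /t mulNr subr_ge0 -ler_pdivlMr.
pose P i := w i 0 + t * v i 0 = 0.
(* At a zero of w + t v, the inequalities A w <= w and A (w + t v) >= 0 give (A v)_i >= v_i. So A v
   <= M v <= v is an equality in row i; as v > 0, the rows of A and M agree, and w + t v vanishes at
   every successor of i. *)
have key i : P i -> (A *m v) i 0 = v i 0 /\
    forall j, 0 < M i j -> P j.
  rewrite /P => Pi.
  have e1 : 0 <= \sum_j A i j * (w j 0 + t * v j 0).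
    by apply: sumr_ge0 => j _; apply: mulr_ge0 => //; have := A0 i j; rewrite mxE.
  have e2 : 0 <= \sum_j (M i j - A i j) * v j 0.
    by apply: sumr_ge0 => j _; apply: mulr_ge0; rewrite ?subr_ge0 ?AM ?ltW.
  have e3 : \sum_j A i j * (w j 0 + t * v j 0) = (A *m w) i 0 + t * (A *m v) i 0.
    rewrite !mxE mulr_sumr -big_split /=; apply: eq_bigr => j _; ring.
  have e4 : \sum_j (M i j - A i j) * v j 0 = (M *m v) i 0 - (A *m v) i 0.
    rewrite !mxE -sumrB; apply: eq_bigr => j _; ring.
  have w1 := wA i 0; rewrite !mxE subr_ge0 in w1.
  have w2 := Mv i 0.
  have w3 : (A *m w) i 0 <= w i 0 by rewrite mxE.
  have h1 : (A *m v) i 0 = v i 0.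
    apply/eqP; rewrite eq_le; apply/andP; split; first by lra.
    by rewrite -(ler_pM2l t0); lra.
  have h2 : (M *m v) i 0 - (A *m v) i 0 = 0 by lra.
  have h3 : (A *m w) i 0 + t * (A *m v) i 0 = 0.
    by apply/eqP; rewrite eq_le -{2}e3 e1 andbT h1; lra.
  split=> // j Mij.
  have aE : A i j = M i j.
    move: h2; rewrite -e4 => /eqP; rewrite psumr_eq0; last first.
      by move=> l _; apply: mulr_ge0; rewrite ?subr_ge0 ?AM ?ltW.
    move=> /allP/(_ j (mem_index_enum _)) /=.
    by rewrite mulf_eq0 (gt_eqF (v0 j)) orbF subr_eq0 => /eqP.
  move: h3; rewrite -e3 => /eqP; rewrite psumr_eq0; last first.
    by move=> l _; apply: mulr_ge0 => //; have := A0 i l; rewrite mxE.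
  move=> /allP/(_ j (mem_index_enum _)) /=.
  by rewrite mulf_eq0 aE (gt_eqF Mij) /= => /eqP.
have Pk : P k.
  apply: (connect_invariant _ (irM i1 k)) => [a b ab Pa|].
    by have [_] := key a Pa; apply.
  by rewrite /P /t mulNr divfK ?subrr // gt_eqF.
by have [Ak _] := key k Pk; move: Avk; rewrite Ak ltxx.
Qed.

End Order.

(** * Cone vectors *)

Section Cone.
Variable R : realType.

Lemma irreducible_mx_tr m (A : 'M[R]_m) : irreducible_mx A -> irreducible_mx A^T.
Proof.
move=> irA i j; have := irA j i; rewrite connect_rev /=.
by rewrite (@eq_connect _ _ [rel a b | 0 < A^T a b]) // => a b; rewrite /= mxE.
Qed.

(** Along an edge from a to c, b v_c <= A_ac v_c <= (A v)_a <= v_a. With the transpose it serves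
    left vectors too. *)
Lemma cone_ratio m (A : 'M[R]_m) (v : 'cV[R]_m) (b : R) i j :
  0 <= b <= 1 -> lemx 0 A -> (forall i j, 0 < A i j -> b <= A i j) ->
  irreducible_mx A -> lemx 0 v -> lemx (A *m v) v ->
  b ^+ m * v j 0 <= v i 0.
Proof.
move=> b01 A0 Ab irA v0 Av.
have v0' a : 0 <= v a 0 by have := v0 a 0; rewrite mxE.
rewrite -[X in b ^+ X]card_ord.
apply: (connect_decay (f := fun a => v a 0) _ _ _ (irA i j)) => //.
move=> a c /= /Ab bA; apply: le_trans (Av a 0); rewrite mxE (bigD1 c) //=.
apply: (@le_trans _ _ (A a c * v c 0)); first exact: ler_wpM2r.
rewrite lerDl; apply: sumr_ge0 => k _; apply: mulr_ge0 => //.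
by have := A0 a k; rewrite mxE.
Qed.

(* If I - A is invertible, (I - A)^-1 1 is a cone vector.  Otherwise A w = w for
   some w <> 0, and |w| works: the inequality |w| <= A |w| is an equality, as
   the left vectors u_t with u_t (I - t A) = 1 show for t -> 1. *)
Lemma cone_vector m (A : 'M[R]_m) (b : R) :
  0 < b <= 1 -> lemx 0 A -> (forall i j, 0 < A i j -> b <= A i j) ->
  irreducible_mx A ->
  (forall t : R, 0 < t < 1 -> inverse_positive (1%:M - t *: A)) ->
  exists2 v : 'cV[R]_m, (forall i, 0 < v i 0) & lemx (A *m v) v.
Proof.
move=> /andP[b0 b1] A0 Ab irA sub1.
have A0' i j : 0 <= A i j by have := A0 i j; rewrite mxE.
have [uA|sA] := boolP (1%:M - A \in unitmx).
  pose w : 'cV[R]_m := invmx (1%:M - A) *m const_mx 1.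
  have Aw : w - A *m w = const_mx 1 by rewrite -mulmx1BE mulKVmx.
  pose B := 1 + \sum_i `|(A *m w) i 0|.
  have B1 : 1 <= B by rewrite lerDl; apply: sumr_ge0.
  have BA i : `|(A *m w) i 0| <= B.
    rewrite /B (bigD1 i) //= addrCA lerDl addr_ge0 //; exact: sumr_ge0.
  have B0 : 0 < B by lra.
  (* [k] makes the entries of k A w at most 1/2 in absolute value, so (I - (1 - k) A) w = 1 + k A w
     is nonnegative, and subcriticality at 1 - k gives w >= 0. *)
  pose k := (2 * B)^-1.
  have k0 : 0 < k by rewrite invr_gt0; lra.
  have kB : k * B = 2^-1 by rewrite /k invfM -mulrA mulVf ?mulr1 // gt_eqF.
  have k1 : k <= 2^-1 by rewrite -kB ler_peMr // ltW.
  have w0 : lemx 0 w.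
    have /sub1 : 0 < 1 - k < 1 by lra.
    have E : (1%:M - (1 - k) *: A) *m w = const_mx 1 + k *: (A *m w).
      by rewrite mulmx1BE -scalemxAl scalerBl scale1r -Aw opprB addrCA addrC.
    apply=> i j; have := BA i; rewrite E (ord1 j); move: (A *m w) => z zB.
    have : - (k * `|z i 0|) <= k * z i 0.
      rewrite -mulrN; apply: ler_wpM2l; first exact: ltW.
      by rewrite lerNl -normrN ler_norm.
    have : k * `|z i 0| <= k * B by apply: ler_wpM2l => //; apply: ltW.
    by rewrite !mxE; lra.
  have Aw0 : lemx 0 (A *m w) by apply: lemx_mul0.
  have wE i : w i 0 = 1 + (A *m w) i 0.
    by have /matrixP/(_ i 0) := Aw; rewrite !mxE; lra.
  exists w => [i|i j].
    by rewrite wE; have := Aw0 i 0; rewrite !mxE; lra.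
  by rewrite (ord1 j) (wE i); lra.
have [w w0 Aw] : exists2 w : 'cV[R]_m, w != 0 & A *m w = w.
  move: sA; rewrite -unitmx_tr -row_free_unit -kermx_eq0 => /rowV0Pn[v /sub_kermxP].
  move=> vA v0; exists v^T; first by rewrite -trmx0 (inj_eq trmx_inj).
  apply/eqP; rewrite eq_sym -subr_eq0 -mulmx1BE; apply/eqP.
  by apply: trmx_inj; rewrite trmx_mul trmxK vA trmx0.
pose a : 'cV[R]_m := map_mx Num.norm w.
have aE i : a i 0 = `|w i 0| by rewrite mxE.
have a0 : lemx 0 a by move=> i j; rewrite !mxE.
have a0' i : 0 <= a i 0 by rewrite aE.
have aA i : a i 0 <= (A *m a) i 0.
  rewrite aE -{1}Aw !mxE; apply: le_trans (ler_norm_sum _ _ _) _.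
  apply: ler_sum => j _; rewrite normrM aE ler_wpM2r //.
  by rewrite ger0_norm.
have Aa : lemx (A *m a) a.
  move=> i j; rewrite (ord1 j) leNgt; apply/negP; rewrite -subr_gt0.
  set d := _ - _ => d0; pose s := \sum_j a j 0.
  have s0 : 0 <= s by apply: sumr_ge0.
  (* [C] will compare the entries of the left vector u of (1 - k) A. The factor b / 2 covers (1 - k)
     b for all k <= 1/4, so [C] does not depend on [k]. *)
  pose C := (b / 2) ^+ m.
  have C0 : 0 < C by rewrite exprn_gt0 // divr_gt0.
  have Cd0 : 0 < C * d by apply: mulr_gt0.
  (* Small against the supposed gap [d]: 4 k s <= C d. Pairing the gap with u will give (1 - k) C d
     <= k s, which is then impossible. *)
  pose k := (C * d) / (4 * (s + C * d)).
  have den0 : 0 < 4 * (s + C * d) by lra.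
  have k0 : 0 < k by rewrite divr_gt0.
  have k4 : k <= 4^-1.
    by rewrite /k ler_pdivrMr //; lra.
  have ks : 4 * (k * s) <= C * d.
    have -> : 4 * (k * s) = (C * d) * (s / (s + C * d)).
      by rewrite /k; field; rewrite gt_eqF //; lra.
    apply: ler_piMr; first exact: ltW.
    by rewrite ler_pdivrMr; lra.
  have t01 : 0 < 1 - k < 1 by lra.
  have /inverse_positive_tr pT := sub1 _ t01.
  have uT := inverse_positive_unit pT.
  have [u uE1] : exists u : 'cV[R]_m,
      (1%:M - (1 - k) *: A)^T *m u = const_mx 1.
    by exists (invmx (1%:M - (1 - k) *: A)^T *m const_mx 1); rewrite mulKVmx.
  have u0 l : 0 <= u l 0.
    by have := pT u _ l 0; rewrite mxE; apply; rewrite uE1 => ? ?; rewrite !mxE.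
  have uE l : u l 0 = 1 + (1 - k) * \sum_l' A l' l * u l' 0.
    have /matrixP/(_ l 0) := uE1.
    rewrite linearB linearZ /= trmx1 mulmx1BE -scalemxAl !mxE.
    have -> : \sum_j A^T l j * u j 0 = \sum_l' A l' l * u l' 0.
      by apply: eq_bigr => l' _; rewrite mxE.
    by lra.
  have uC i1 i2 : C * u i2 0 <= u i1 0.
    rewrite /C -[X in _ ^+ X]card_ord.
    apply: (connect_decay (f := fun l => u l 0) _ _ _
      (irreducible_mx_tr irA i1 i2)) => //; first by lra.
    move=> x y /=; rewrite mxE => /Ab bA; rewrite [leRHS]uE (bigD1 y) //=.
    have : 0 <= \sum_(l' | l' != y) A l' x * u l' 0.
      by apply: sumr_ge0 => l' _; apply: mulr_ge0.
    set z := \sum_(_ | _) _ => z0.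
    have : b * u y 0 <= A y x * u y 0 by apply: ler_wpM2r.
    set Au := A y x * u y 0; have := u0 y; set uy := u y 0 => uy0 bAu.
    have : 0 <= (1 - k) * z by apply: mulr_ge0; lra.
    have : (1 - k) * (b * uy) <= (1 - k) * Au by apply: ler_wpM2l; lra.
    have : (1 - k - 2^-1) * (b * uy) >= 0.
      by apply: mulr_ge0; [lra|apply: mulr_ge0; lra].
    by rewrite mulrDr; lra.
  have bal : (1 - k) * \sum_l u l 0 * (A *m a) l 0 = \sum_l (u l 0 - 1) * a l 0.
    transitivity ((1 - k) * \sum_l' (\sum_l A l l' * u l 0) * a l' 0).
      congr (_ * _).
      under eq_bigr do rewrite mxE mulr_sumr.
      under [RHS]eq_bigr do rewrite mulr_suml.
      rewrite exchange_big /=; apply: eq_bigr => x _; apply: eq_bigr => y _.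
      by ring.
    rewrite mulr_sumr; apply: eq_bigr => l _; rewrite (uE l); ring.
  have sum_ge : C * (\sum_l u l 0 * a l 0) <= u i 0 * s.
    rewrite !mulr_sumr; apply: ler_sum => l _; rewrite mulrA.
    by apply: ler_wpM2r.
  have sum_le : u i 0 * d <= \sum_l u l 0 * ((A *m a) l 0 - a l 0).
    rewrite (bigD1 i) //= lerDl; apply: sumr_ge0 => l _.
    by apply: mulr_ge0; rewrite ?subr_ge0.
  have sumB : \sum_l u l 0 * ((A *m a) l 0 - a l 0)
      = \sum_l u l 0 * (A *m a) l 0 - \sum_l u l 0 * a l 0.
    by rewrite -sumrB; apply: eq_bigr => l _; rewrite mulrBr.
  have sumB1 : \sum_l (u l 0 - 1) * a l 0 = \sum_l u l 0 * a l 0 - s.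
    by rewrite -sumrB; apply: eq_bigr => l _; rewrite mulrBl mul1r.
  have ui : 1 <= u i 0.
    rewrite uE lerDl; apply: mulr_ge0; first lra.
    by apply: sumr_ge0 => l _; apply: mulr_ge0.
  move: bal sum_ge sum_le; rewrite sumB sumB1.
  set X := \sum_l u l 0 * (A *m a) l 0; set Y := \sum_l u l 0 * a l 0.
  move=> bal sum_ge sum_le.
  have e1 : (1 - k) * (u i 0 * d) <= k * Y.
    have : (1 - k) * (u i 0 * d) <= (1 - k) * (X - Y) by apply: ler_wpM2l; lra.
    by lra.
  have e2 : C * ((1 - k) * (u i 0 * d)) <= k * (u i 0 * s).
    apply: (@le_trans _ _ (C * (k * Y))); first by apply: ler_wpM2l; lra.
    by rewrite mulrCA; apply: ler_wpM2l; lra.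
  have e3 : (1 - k) * (C * d) <= k * s.
    rewrite -(@ler_pM2l _ (u i 0)); first by lra.
    by lra.
  have e4 : (1 - 4^-1) * (C * d) <= (1 - k) * (C * d) by apply: ler_wpM2r; lra.
  by lra.
exists a => // i.
have [j wj] : exists j, w j 0 != 0.
  apply/existsP; apply: contraNT w0; rewrite negb_exists => /forallP w0.
  by apply/eqP/colP => j; rewrite mxE; apply/eqP; have := w0 j; rewrite negbK.
apply: lt_le_trans (cone_ratio i j _ A0 Ab irA a0 Aa); last by lra.
by rewrite aE mulr_gt0 ?exprn_gt0 // normr_gt0.
Qed.

End Cone.

(** * Quadratic maps *)

Section Tarski.
Variables (R : realType) (m : nat).

(** The coordinatewise supremum of the postfixed points in the box is a fixed point; monotonicity on
    nonnegative vectors is enough. *)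
Lemma tarski_box (F : 'cV[R]_m -> 'cV[R]_m) (b : 'cV[R]_m) :
  lemx 0 b -> lemx 0 (F 0) -> lemx (F b) b ->
  (forall x y, lemx 0 x -> lemx x y -> lemx (F x) (F y)) ->
  exists s, [/\ lemx 0 s, lemx s b & F s = s].
Proof.
move=> b0 F0 Fb Fmono.
pose post x := [/\ lemx 0 x, lemx x b & lemx x (F x)].
pose E i : classical_sets.set R := fun r => exists2 x, post x & r = x i 0.
have E0 i : E i 0.
  by exists 0; rewrite ?mxE //; split=> // ? ?; rewrite mxE.
have Eb i : classical_sets.ubound (E i) (b i 0).
  by move=> _ [x [_ xb _] ->]; apply: xb.
have Esup i : classical_sets.has_sup (E i) by split; [exists 0|exists (b i 0)].
pose s : 'cV[R]_m := \col_i sup (E i).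
have xs x : post x -> lemx x s.
  move=> px i j; rewrite (ord1 j) mxE; apply: (sup_upper_bound (Esup i)).
  by exists x.
have s0 : lemx 0 s by apply: xs; split=> // ? ?; rewrite mxE.
have sb : lemx s b.
  move=> i j; rewrite (ord1 j) mxE; apply: ge_sup (Eb i); by exists 0.
have sF : lemx s (F s).
  move=> i j; rewrite (ord1 j) [leLHS]mxE; apply: ge_sup; first by exists 0.
  move=> _ [x px ->]; have [x0 _ xF] := px.
  by apply: le_trans (xF i 0) _; apply: Fmono => //; apply: xs.
have Fs : lemx (F s) s.
  apply: xs; split.
  - by apply: lemx_trans F0 _; apply: Fmono => // ? ?; rewrite mxE.
  - by apply: lemx_trans Fb; apply: Fmono.
  - by apply: Fmono.
exists s; split=> //; apply/matrixP => i j.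
by apply/eqP; rewrite eq_le Fs sF.
Qed.

End Tarski.

(** The Jacobian at [x] of the quadratic map whose gradient at 0 is [L] and whose Hessians are the
    [H i]. *)
Definition qjac (R : realType) m (L : 'M[R]_m) (H : 'I_m -> 'M[R]_m)
    (x : 'cV[R]_m) : 'M[R]_m :=
  \matrix_(i, j) (L i j + \sum_k H i j k * x k 0).

(* c + L x + H(x, x) / 2 *)
Definition qmap (R : realType) m (c : 'cV[R]_m) (L : 'M[R]_m)
    (H : 'I_m -> 'M[R]_m) (x : 'cV[R]_m) : 'cV[R]_m :=
  c + 2^-1 *: ((L + qjac L H x) *m x).

Section QuadraticMap.
Variables (R : realType) (m : nat) (H : 'I_m -> 'M[R]_m).
Hypothesis H0 : forall i, lemx 0 (H i).
Hypothesis Hsym : forall i j k, H i j k = H i k j.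
Implicit Types (c x y q : 'cV[R]_m) (L : 'M[R]_m).

Let Hge0 i j k : 0 <= H i j k.
Proof. by have := H0 i j k; rewrite mxE. Qed.

Lemma qjac_swap L x y : qjac L H x *m y - L *m y = qjac L H y *m x - L *m x.
Proof.
have E a b i : (qjac L H a *m b - L *m b) i 0
    = \sum_j \sum_k H i j k * a k 0 * b j 0.
  rewrite !entryE !(mxE mulmx_key) -sumrB; apply: eq_bigr => j _.
  by rewrite mxE -mulr_suml; ring.
apply/colP => i; rewrite !E exchange_big /=; apply: eq_bigr => k _.
by apply: eq_bigr => j _; rewrite Hsym; ring.
Qed.

(** The mean value formula with the trapezoidal rule, which is exact because the Jacobian is affine;
    the mixed terms cancel by symmetry of [H]. *)
Lemma qmap_sub c L x y :
  qmap c L H x - qmap c L H y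
    = 2^-1 *: ((qjac L H x + qjac L H y) *m (x - y)).
Proof.
rewrite /qmap opprD addrACA subrr add0r -scalerBr; congr (_ *: _).
have := qjac_swap L x y; rewrite !mulmxDl !mulmxBr.
move: (qjac L H x *m x) (qjac L H x *m y) (qjac L H y *m x) (qjac L H y *m y)
  (L *m x) (L *m y) => a b c' d e f E.
have -> : c' = b - f + e by rewrite E subrK.
by apply/colP => i; rewrite !mxE; ring.
Qed.

Lemma qjac_le L L' x y :
  lemx L L' -> lemx x y -> lemx (qjac L H x) (qjac L' H y).
Proof.
move=> LL xy i j; rewrite !mxE; apply: lerD => //.
by apply: ler_sum => k _; apply: ler_wpM2l.
Qed.

Lemma qjac_ge0 L x : lemx 0 L -> lemx 0 x -> lemx 0 (qjac L H x).
Proof.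
move=> L0 x0 i j; rewrite !mxE; apply: addr_ge0.
  by have := L0 i j; rewrite mxE.
apply: sumr_ge0 => k _; apply: mulr_ge0 => //.
by have := x0 k 0; rewrite mxE.
Qed.

Lemma qmap_le c c' L L' x y : lemx 0 L -> lemx 0 x ->
  lemx c c' -> lemx L L' -> lemx x y -> lemx (qmap c L H x) (qmap c' L' H y).
Proof.
move=> L0 x0 cc LL xy i j; rewrite !entryE.
apply: lerD; first exact: cc.
apply: ler_wpM2l; first by rewrite invr_ge0.
apply: lemx_mul => // a b; rewrite !entryE.
  apply: addr_ge0; first by have := L0 a b; rewrite mxE.
  by have := qjac_ge0 L0 x0 a b; rewrite zeromx_entry.
by apply: lerD; rewrite ?LL //; apply: qjac_le.
Qed.

Lemma qmap0 c L : qmap c L H 0 = c.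
Proof. by rewrite /qmap mulmx0 scaler0 addr0. Qed.

(* For a >= 0 with a <= t M a and small e > 0, q - e a is a prefixed point. *)
Lemma lfp_subcritical c L q :
  lemx 0 L -> (forall i, 0 < q i 0) -> qmap c L H q = q ->
  (forall x, lemx 0 x -> lemx (qmap c L H x) x -> lemx q x) ->
  forall t : R, 0 < t < 1 -> inverse_positive (1%:M - t *: qjac L H q).
Proof.
move=> L0 q0 qfix least t /andP[t0 t1] w; rewrite mulmx1BE -scalemxAl => wM.
have q0' : lemx 0 q by move=> i j; rewrite mxE (ord1 j) ltW.
pose M := qjac L H q; pose a : 'cV[R]_m := \col_i Num.max (- w i 0) 0.
have M0 : lemx 0 M by apply: qjac_ge0.
have M0' i j : 0 <= M i j by have := M0 i j; rewrite zeromx_entry.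
have a0 i : 0 <= a i 0 by rewrite mxE le_max lexx orbT.
have aw i : - w i 0 <= a i 0 by rewrite mxE le_max lexx.
have Ma0 i : 0 <= (M *m a) i 0.
  by rewrite mxE; apply: sumr_ge0 => j _; apply: mulr_ge0.
have aM i : a i 0 <= t * (M *m a) i 0.
  rewrite mxE ge_max; apply/andP; split; last by apply: mulr_ge0 => //; apply: ltW.
  have := wM i 0; rewrite -/M !entryE subr_ge0 => h.
  rewrite lerNl; apply: le_trans h; rewrite -mulrN; apply: ler_wpM2l.
    exact: ltW.
  rewrite !mxE -sumrN; apply: ler_sum => j _.
  by rewrite -mulrN; apply: ler_wpM2l; rewrite // lerNl.
pose r k := a k 0 / ((1 - t) * q k 0).
have den k : 0 < (1 - t) * q k 0 by apply: mulr_gt0; rewrite ?subr_gt0.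
have r0 k : 0 <= r k by apply: divr_ge0 => //; apply: ltW.
(* [s] dominates every ratio a_k / ((1 - t) q_k). With e = 1/s the vector q - e a stays above t q,
   so its Jacobian stays above t M. *)
pose s := 1 + \sum_k r k.
have s1 : 1 <= s by rewrite lerDl; apply: sumr_ge0.
pose e := s^-1; have e0 : 0 < e by rewrite invr_gt0; lra.
have er k : e * a k 0 <= (1 - t) * q k 0.
  rewrite -[leRHS]mul1r -ler_pdivrMr // -mulrA -/(r k) mulrC ler_pdivrMr; last by lra.
  rewrite mul1r /s (bigD1 k) //= addrCA lerDl addr_ge0 //.
  by apply: sumr_ge0.
pose p := q - e *: a.
have pE k : p k 0 = q k 0 - e * a k 0 by rewrite !entryE.
have pt k : t * q k 0 <= p k 0 by rewrite pE; have := er k; lra.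
have p0 : lemx 0 p.
  move=> i j; rewrite (ord1 j) zeromx_entry; apply: le_trans (pt i).
  by apply: mulr_ge0 => //; apply: ltW.
have Jp i j : t * M i j <= qjac L H p i j.
  rewrite !mxE mulrDr; apply: lerD.
    by apply: ler_piMl; [have := L0 i j; rewrite mxE|apply: ltW].
  rewrite mulr_sumr; apply: ler_sum => k _; rewrite mulrCA.
  by apply: ler_wpM2l.
(* The prefixed point inequality reduces to 2 a <= 2 t M a <= (1 + t) M a <= (J(p) + M) a. Leastness
   then gives q <= q - e a, so a = 0. *)
have qp : lemx q p.
  apply: least => // i j; rewrite (ord1 j).
  have : (qmap c L H p - q) i 0 = - (e * 2^-1 * ((qjac L H p + M) *m a) i 0).
    rewrite -{1}qfix qmap_sub /p addrAC subrr add0r mulmxN -scalemxAr.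
    by rewrite !entryE mulrN mulrA [2^-1 * e]mulrC.
  have : (1 + t) * (M *m a) i 0 <= ((qjac L H p + M) *m a) i 0.
    rewrite mulmxDl [leRHS]addmx_entry mulrDl mul1r addrC lerD2r.
    rewrite !mxE mulr_sumr; apply: ler_sum => k _; rewrite mulrA.
    by apply: ler_wpM2r.
  rewrite pE !entryE -/M.
  have := aM i; have := Ma0 i.
  move: ((qjac L H p + M) *m a) (M *m a) (qmap c L H p) => X Y Z y0 ay xy zE.
  have : e * (2 * a i 0) <= e * X i 0.
    apply: ler_wpM2l; first exact: ltW.
    have : 0 <= (1 - t) * Y i 0 by apply: mulr_ge0; lra.
    lra.
  lra.
move=> i j; rewrite (ord1 j) zeromx_entry.
have := qp i 0; rewrite pE => h; have : e * a i 0 <= 0 by lra.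
rewrite pmulr_rle0 // => ai; have := aw i; lra.
Qed.

End QuadraticMap.

(** * Rounded-down Newton's method on one SCC *)

Section Rounding.
Variables (R : realType) (h : int).

Lemma round_down_ge0 (x : R) : 0 <= round_down h x.
Proof.
apply: mulr_ge0; last exact: exprz_ge0.
rewrite (ler_int R 0) floor_ge0.
by apply: mulr_ge0; [rewrite le_max lexx orbT|apply: exprz_ge0].
Qed.

Lemma round_down_le (x : R) : round_down h x <= Num.max x 0.
Proof.
have E : Num.max x 0 = Num.max x 0 * 2 ^ h * 2 ^ (- h).
  by rewrite -mulrA -expfzDr ?pnatr_eq0 // subrr expr0z mulr1.
by rewrite [leRHS]E; apply: ler_wpM2r; [apply: exprz_ge0|apply: floor_le].
Qed.

Lemma round_down_gt (x : R) : x - 2 ^ (- h) <= round_down h x.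
Proof.
have h0 : (2 : R) ^ (- h) > 0 by rewrite exprz_gt0.
apply: (@le_trans _ _ (Num.max x 0 - 2 ^ (- h))).
  by rewrite lerD2r le_max lexx.
have E : Num.max x 0 = Num.max x 0 * 2 ^ h * 2 ^ (- h).
  by rewrite -mulrA -expfzDr ?pnatr_eq0 // subrr expr0z mulr1.
rewrite {1}E -[X in _ - X]mul1r -mulrBl; apply: ler_wpM2r; first exact: ltW.
by rewrite lerBlDr ltW // -[X in _ < _ + X]/(1%:~R) -intrD floorD1_gt.
Qed.

End Rounding.

(** * One SCC with exact data [c0], [L0] and lower data [c1], [L1] *)

Section SccStep.
Variables (R : realType) (m : nat) (H : 'I_m -> 'M[R]_m).
Variables (c0 c1 : 'cV[R]_m) (L0 L1 : 'M[R]_m) (q : 'cV[R]_m).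
Variables (P : system R m) (h : int) (b : R).
Hypothesis H0 : forall i, lemx 0 (H i).
Hypothesis Hsym : forall i j k, H i j k = H i k j.
Hypothesis c1_ge0 : lemx 0 c1.
Hypothesis c1_le : lemx c1 c0.
Hypothesis L1_ge0 : lemx 0 L1.
Hypothesis L1_le : lemx L1 L0.
Hypothesis q_gt0 : forall i, 0 < q i 0.
Hypothesis q_fix : qmap c0 L0 H q = q.
Hypothesis q_least :
  forall x, lemx 0 x -> lemx (qmap c0 L0 H x) x -> lemx q x.
Hypothesis evalP : forall x, eval_sys P x = qmap c1 L1 H x.
Hypothesis jacP : forall x, jacobian P x = qjac L1 H x.
Hypothesis b01 : 0 < b <= 1.
Let M := qjac L0 H q.
Hypothesis M_irr : irreducible_mx M.
Hypothesis M_edge : forall i j, 0 < M i j -> b <= M i j.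

Let F1 := qmap c1 L1 H.
Let J1 := qjac L1 H.
Let D := q - F1 q.

Let Hge0 i j k : 0 <= H i j k.
Proof. by have := H0 i j k; rewrite zeromx_entry. Qed.

Let L0_ge0 : lemx 0 L0.
Proof. exact: lemx_trans L1_ge0 L1_le. Qed.

Let q_ge0 : lemx 0 q.
Proof. by move=> i j; rewrite zeromx_entry (ord1 j) ltW. Qed.

Let M_ge0 : lemx 0 M.
Proof. exact: qjac_ge0. Qed.

Let F1q_le : lemx (F1 q) q.
Proof. by rewrite -{2}q_fix; apply: qmap_le => //; apply: lemx_refl. Qed.

Let D_ge0 i : 0 <= D i 0.
Proof. by rewrite /D addmx_entry oppmx_entry subr_ge0; apply: F1q_le. Qed.

(** Left free in [p] because it is used twice: for p = q' the first term on the right vanishes, for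
    p = q it is the defect [D]. *)
Lemma newton_residual x : inverse_positive (1%:M - J1 x) ->
  exists2 N, newton P x = Some N & forall p,
    (1%:M - J1 x) *m (p - N) = (p - F1 p) + 2^-1 *: ((J1 p - J1 x) *m (p - x)).
Proof.
move=> pos; have uA := inverse_positive_unit pos.
exists (x + invmx (1%:M - J1 x) *m (F1 x - x)).
  by rewrite /newton jacP evalP -/(J1 x) uA.
move=> p; rewrite opprD addrA mulmxBr mulKVmx // mulmx1BE.
have := qmap_sub Hsym c1 L1 p x; rewrite -/(F1 p) -/(F1 x) -/(J1 p) -/(J1 x).
rewrite mulmxDl mulmxBl; move: (J1 p *m _) (J1 x *m _) (F1 p) (F1 x) => A B Fp Fx E.
have -> : Fp = 2^-1 *: (A + B) + Fx by rewrite -E subrK.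
by apply/colP => i; rewrite !entryE; field.
Qed.

(** [D i 0] is the sum of c0 - c1 and of the terms (L0 - L1) q_j in row i, all nonnegative, with q_j
    > 0. *)
Lemma qmap_defect_eq0 i : D i 0 = 0 -> forall j, L1 i j = L0 i j.
Proof.
have E : D i 0 = (c0 i 0 - c1 i 0) + \sum_j (L0 i j - L1 i j) * q j 0.
  rewrite /D -{1}q_fix /F1 /qmap !entryE !mxE.
  rewrite opprD addrACA -mulrBr -sumrB mulr_sumr; congr (_ + _).
  by apply: eq_bigr => j _; rewrite !mxE; field.
move=> D0 j.
have s0 k : 0 <= (L0 i k - L1 i k) * q k 0.
  by apply: mulr_ge0; [rewrite subr_ge0|apply: ltW].
have : \sum_j (L0 i j - L1 i j) * q j 0 == 0.
  rewrite eq_le sumr_ge0 // andbT.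
  by have := c1_le i 0; move: D0; rewrite E; lra.
rewrite psumr_eq0 // => /allP/(_ j (mem_index_enum _)) /=.
by rewrite mulf_eq0 (gt_eqF (q_gt0 j)) orbF subr_eq0 => /eqP.
Qed.

Lemma scc_cone : exists2 v : 'cV[R]_m, (forall i, 0 < v i 0) & lemx (M *m v) v.
Proof.
apply: cone_vector b01 M_ge0 M_edge M_irr _.
move=> t t01; exact: (lfp_subcritical H0 Hsym L0_ge0 q_gt0 q_fix q_least t01).
Qed.

Lemma scc_left_cone :
  exists2 u : 'cV[R]_m, (forall i, 0 < u i 0) & lemx (M^T *m u) u.
Proof.
apply: (@cone_vector _ _ _ b) => //.
- by move=> i j; rewrite [leRHS]mxE zeromx_entry; have := M_ge0 j i; rewrite mxE.
- by move=> i j; rewrite mxE; apply: M_edge.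
- exact: irreducible_mx_tr.
move=> t t01; have := lfp_subcritical H0 Hsym L0_ge0 q_gt0 q_fix q_least t01.
by move=> /inverse_positive_tr; rewrite linearB linearZ /= trmx1.
Qed.

(** The perturbed map sends the box from 0 to [q] into itself. Any fixed point there will do; its
    leastness is not claimed. *)
Lemma scc_fixpoint : exists q', [/\ lemx 0 q', lemx q' q & F1 q' = q'].
Proof.
apply: tarski_box => //; first by rewrite /F1 qmap0.
by move=> x y x0 xy; apply: qmap_le => //; apply: lemx_refl.
Qed.

(** * Newton iterations and perturbation in a nonlinear SCC *)

Section Nonlinear.
Variables (i0 j0 k0 : 'I_m).
Hypothesis H_gt0 : 0 < H i0 j0 k0.

(** The invariant keeps x <= q' and, separately, x < q in every coordinate: q' may equal q, and the
    strict inequality is what makes I - J1(x) invertible with nonnegative inverse. *)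
Lemma rnm_step_nonlinear (v q' x : 'cV[R]_m) (lam : R) :
  (forall i, 0 < v i 0) -> lemx (M *m v) v ->
  lemx 0 q' -> lemx q' q -> F1 q' = q' ->
  lemx 0 x -> (forall i, x i 0 < q i 0) -> lemx x q' -> 0 <= lam ->
  (forall i, q' i 0 - x i 0 <= lam * v i 0) ->
  exists2 x', rnm_step h P x = Some x' &
    [/\ lemx 0 x', forall i, x' i 0 < q i 0, lemx x' q' &
        forall i, q' i 0 - x' i 0 <= lam / 2 * v i 0 + 2 ^ (- h)].
Proof.
move=> v0 Mv q'0 q'q q'fix x0 xq xq' lam0 xlam.
have dq' k : 0 <= q' k 0 - x k 0 by rewrite subr_ge0; apply: xq'.
have dq k : 0 <= q k 0 - x k 0 by rewrite subr_ge0 ltW.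
have xq_le : lemx x q by move=> i j; rewrite (ord1 j) ltW.
have J1M : lemx (J1 x) M by apply: qjac_le.
have J10 : lemx 0 (J1 x) by apply: qjac_ge0.
have J10' i j : 0 <= J1 x i j by have := J10 i j; rewrite zeromx_entry.
(* Row i0 is the strict row: its entry j0 contains H i0 j0 k0 x_k0, which is smaller than H i0 j0 k0
   q_k0. *)
have J1v : (J1 x *m v) i0 0 < v i0 0.
  apply: lt_le_trans (Mv i0 0); rewrite !mxE.
  rewrite (bigD1 j0) //= [ltRHS](bigD1 j0) //=; apply: ltr_leD.
    rewrite ltr_pM2r // !mxE; apply: ler_ltD; first exact: L1_le.
    rewrite (bigD1 k0) //= [ltRHS](bigD1 k0) //=; apply: ltr_leD.
      by rewrite ltr_pM2l.
    by apply: ler_sum => k _; apply: ler_wpM2l => //; apply: ltW.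
  by apply: ler_sum => j _; apply: ler_wpM2r; [apply: ltW|apply: J1M].
have pos : inverse_positive (1%:M - J1 x).
  exact: inverse_positive_sub1 J10 J1M M_irr v0 Mv J1v.
have [N NE res] := newton_residual pos.
have quadE p i : ((J1 p - J1 x) *m (p - x)) i 0
    = \sum_j \sum_k H i j k * (p k 0 - x k 0) * (p j 0 - x j 0).
  rewrite (mxE mulmx_key); apply: eq_bigr => j _; rewrite !entryE !mxE.
  rewrite opprD addrACA subrr add0r -sumrB -mulr_suml; congr (_ * _).
  by apply: eq_bigr => k _; rewrite mulrBr.
have Nq' : lemx N q'.
  have := pos (q' - N); rewrite res q'fix subrr add0r => Hpos.
  move=> i j; rewrite -subr_ge0; have := Hpos _ i j; rewrite !entryE; apply.
  move=> a c; rewrite (ord1 c) !entryE quadE; apply: mulr_ge0.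
    by rewrite invr_ge0.
  by apply: sumr_ge0 => l _; apply: sumr_ge0 => k _; rewrite !mulr_ge0.
have quad_ge0 a : 0 <= ((J1 q - J1 x) *m (q - x)) a 0.
  rewrite quadE; apply: sumr_ge0 => l _; apply: sumr_ge0 => k _.
  by rewrite !mulr_ge0.
(* If q - N vanishes in row i, then row i is linear and unaffected by the
   perturbation, so q - N also vanishes in all rows that i depends on. *)
have Nq i : N i 0 < q i 0.
  have [z zdef] : exists z, z = q - N by exists (q - N).
  have zE := res q; rewrite -zdef -/D mulmx1BE in zE.
  have z0 j : 0 <= z j 0.
    have := pos z; rewrite mulmx1BE zE => Hpos.
    have := Hpos _ j 0; rewrite zeromx_entry; apply.
    move=> a c; rewrite (ord1 c) zeromx_entry addmx_entry scalemx_entry.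
    by rewrite addr_ge0 // mulr_ge0 // invr_ge0.
  suff: 0 < z i 0 by rewrite zdef !entryE subr_gt0.
  rewrite lt_neqAle z0 andbT eq_sym; apply/negP => /eqP zi.
  have key a : z a 0 = 0 -> ((J1 q - J1 x) *m (q - x)) a 0 = 0 /\
      forall j, 0 < M a j -> z j 0 = 0.
    move=> za.
    have Jz0 : 0 <= (J1 x *m z) a 0.
      by rewrite mxE; apply: sumr_ge0 => j _; apply: mulr_ge0.
    have /matrixP/(_ a 0) := zE; rewrite addmx_entry oppmx_entry.
    rewrite addmx_entry scalemx_entry za.
    have := D_ge0 a; have := quad_ge0 a => Q0 Da E.
    have Q0' : ((J1 q - J1 x) *m (q - x)) a 0 = 0.
      by move: Jz0 Q0 Da E; move: (_ *m z) (_ *m (q - x)) D => ? ? ?; lra.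
    have D0 : D a 0 = 0.
      by move: Jz0 Q0 Da E; move: (_ *m z) (_ *m (q - x)) D => ? ? ?; lra.
    have Jz : (J1 x *m z) a 0 = 0.
      by move: Jz0 Q0 Da E; move: (_ *m z) (_ *m (q - x)) D => ? ? ?; lra.
    split=> // j Maj.
    have Ha k : H a j k = 0.
      move: Q0'; rewrite quadE => /eqP; rewrite psumr_eq0; last first.
        move=> l _; apply: sumr_ge0 => k' _.
        by rewrite !mulr_ge0.
      move=> /allP/(_ j (mem_index_enum _)) /=; rewrite psumr_eq0; last first.
        by move=> k' _; rewrite !mulr_ge0.
      move=> /allP/(_ k (mem_index_enum _)) /=.
      rewrite !mulf_eq0 !subr_eq0 !(gt_eqF (xq _)) !orbF.
      by move/eqP.
    have JM : J1 x a j = M a j.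
      rewrite !mxE (qmap_defect_eq0 D0); congr (_ + _).
      by apply: eq_bigr => k _; rewrite Ha !mul0r.
    move: Jz; rewrite mxE => /eqP; rewrite psumr_eq0; last first.
      by move=> l _; apply: mulr_ge0.
    move=> /allP/(_ j (mem_index_enum _)) /=.
    by rewrite JM mulf_eq0 (gt_eqF Maj) => /eqP.
  (* The zero spreads from i to i0, whose quadratic remainder then vanishes; but it contains the
     positive term of H i0 j0 k0. *)
  have zi0 : z i0 0 = 0.
    apply: (connect_invariant (P := fun a => z a 0 = 0) _ (M_irr i i0)) zi.
    by move=> a c ac za; have [_] := key a za; apply.
  have [+ _] := key _ zi0; rewrite quadE => /eqP; rewrite psumr_eq0; last first.
    move=> l _; apply: sumr_ge0 => k' _.
    by rewrite !mulr_ge0.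
  move=> /allP/(_ j0 (mem_index_enum _)) /=; rewrite psumr_eq0; last first.
    by move=> k' _; rewrite !mulr_ge0.
  move=> /allP/(_ k0 (mem_index_enum _)) /=.
  by rewrite !mulf_eq0 !subr_eq0 !(gt_eqF (xq _)) !orbF gt_eqF.
(* The halving: (1/2)(J1(q') - J1(x))(q' - x) <= (lam/2)(M - J1(x)) v <= (lam/2)(I - J1(x)) v, to
   which the nonnegative inverse is applied. *)
have Nlam i : q' i 0 - N i 0 <= lam / 2 * v i 0.
  have : lemx (q' - N) ((lam / 2) *: v).
    apply: (inverse_positive_mono pos); rewrite res q'fix subrr add0r.
    move=> a c; rewrite (ord1 c) -scalemxAr !entryE quadE [lam / 2]mulrC -mulrA.
    apply: ler_wpM2l; first by rewrite invr_ge0.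
    apply: (@le_trans _ _ (lam * (\sum_j \sum_k H a j k * (q' k 0 - x k 0) * v j 0))).
      rewrite !mulr_sumr; apply: ler_sum => j _; rewrite !mulr_sumr.
      apply: ler_sum => k _; rewrite [leRHS]mulrCA; apply: ler_wpM2l => //.
      by rewrite mulr_ge0.
    apply: ler_wpM2l => //.
    rewrite mulmx1BE !entryE; apply: (@le_trans _ _ ((M *m v) a 0 - (J1 x *m v) a 0)).
      rewrite !mxE -sumrB; apply: ler_sum => j _; rewrite -mulr_suml -mulrBl.
      apply: ler_wpM2r; first exact: ltW.
      rewrite !mxE -[leLHS]add0r opprD addrACA; apply: lerD.
        by rewrite subr_ge0.
      rewrite -sumrB; apply: ler_sum => k _; rewrite -mulrBr.
      by apply: ler_wpM2l => //; rewrite lerD2r.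
    by rewrite lerD2r.
  by move=> /(_ i 0); rewrite !entryE.
exists (map_mx (round_down h) N); first by rewrite /rnm_step NE.
have rE i : map_mx (round_down h) N i 0 = round_down h (N i 0) by rewrite mxE.
split.
- by move=> i j; rewrite (ord1 j) rE zeromx_entry round_down_ge0.
- move=> i; rewrite rE; apply: le_lt_trans (round_down_le _ _) _.
  by rewrite gt_max Nq q_gt0.
- move=> i j; rewrite (ord1 j) rE; apply: le_trans (round_down_le _ _) _.
  by rewrite ge_max Nq'; have := q'0 i 0; rewrite zeromx_entry.
move=> i; rewrite rE; have := round_down_gt h (N i 0); have := Nlam i.
by lra.
Qed.

(** The error factor obeys t -> t/2 + kap, whose fixed point is 2 kap. *)
Lemma rnm_nonlinear (v q' : 'cV[R]_m) (lam kap : R) k :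
  (forall i, 0 < v i 0) -> lemx (M *m v) v ->
  lemx 0 q' -> lemx q' q -> F1 q' = q' -> 0 <= lam -> 0 <= kap ->
  (forall i, q' i 0 <= lam * v i 0) -> (forall i, 2 ^ (- h) <= kap * v i 0) ->
  exists2 x, rnm h k P = Some x &
    [/\ lemx 0 x, forall i, x i 0 < q i 0, lemx x q' &
        forall i, q' i 0 - x i 0 <= (lam / 2 ^+ k + 2 * kap) * v i 0].
Proof.
move=> v0 Mv q'0 q'q q'fix lam0 kap0 q'lam hkap.
elim: k => [|k [x xE [x0 xq xq' xlam]]].
  exists 0 => //; split=> [i j|i||i]; rewrite ?entryE // subr0 expr0 divr1.
  by apply: le_trans (q'lam i) _; apply: ler_wpM2r; [exact: ltW|lra].
have lam'0 : 0 <= lam / 2 ^+ k + 2 * kap.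
  by rewrite addr_ge0 ?divr_ge0 ?mulr_ge0 ?exprn_ge0.
have [x' x'E [x'0 x'q x'q' x'lam]] :=
  rnm_step_nonlinear v0 Mv q'0 q'q q'fix x0 xq xq' lam'0 xlam.
exists x'; first by move: xE; rewrite /rnm iterS => ->.
split=> // i; apply: le_trans (x'lam i) _; apply: le_trans (lerD (lexx _) (hkap i)) _.
rewrite -mulrDl exprSr invfM mulrA; apply: ler_wpM2r; first exact: ltW.
by lra.
Qed.

(* A left cone vector u of M turns w = D + M w - H(w, w) / 2 into
   u H(w, w) / 2 <= u D. *)
Lemma perturbation_nonlinear (q' : 'cV[R]_m) (cH Dm : R) i :
  lemx 0 q' -> lemx q' q -> F1 q' = q' ->
  (forall i j, 0 < M i j -> b <= J1 (2^-1 *: q) i j) ->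
  0 <= cH <= H i0 j0 k0 -> (forall i, D i 0 <= Dm) ->
  cH * b ^+ (3 * m) * (q i 0 - q' i 0) ^+ 2 <= 2 * m%:R * Dm.
Proof.
move=> q'0 q'q q'fix half /andP[cH0 cHle] DDm.
have [u u0 Mu] := scc_left_cone.
have q'0' a : 0 <= q' a 0 by have := q'0 a 0; rewrite zeromx_entry.
have [w wdef] : exists w, w = q - q' by exists (q - q').
have wqE a : w a 0 = q a 0 - q' a 0 by rewrite wdef !entryE.
have w0 a : 0 <= w a 0 by rewrite wqE subr_ge0; apply: q'q.
have /andP[b0 b1] := b01.
(* [A] is J1 at the midpoint of q and q', which lies above q/2. The hypothesis [half] thus keeps
   every edge of M in [A] with weight at least [b], and w = D + A w makes the entries of w
   comparable. *)
pose A := 2^-1 *: (J1 q + J1 q').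
have wE a : w a 0 = D a 0 + (A *m w) a 0.
  have := qmap_sub Hsym c1 L1 q q'; rewrite -/(F1 q) -/(F1 q') q'fix -wdef.
  move=> /matrixP/(_ a 0); rewrite scalemxAl -/J1 -/A => <-.
  by rewrite wdef /D; move: (F1 q) => y; rewrite !entryE; ring.
have AE a c : A a c = L1 a c + \sum_k H a c k * (q k 0 - 2^-1 * w k 0).
  rewrite scalemx_entry addmx_entry !mxE.
  have -> : \sum_k H a c k * (q k 0 - 2^-1 * w k 0)
      = 2^-1 * (\sum_k H a c k * q k 0 + \sum_k H a c k * q' k 0).
    rewrite -big_split mulr_sumr /=; apply: eq_bigr => k _.
    by rewrite wqE; field.
  by field.
have A_ge0 a c : 0 <= A a c.
  rewrite AE addr_ge0 //; first by have := L1_ge0 a c; rewrite zeromx_entry.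
  apply: sumr_ge0 => k _; rewrite mulr_ge0 // wqE.
  by have := q'0' k; have := q_gt0 k; lra.
have A_edge a c : 0 < M a c -> b <= A a c.
  move=> /half /le_trans; apply; rewrite AE mxE lerD2l.
  apply: ler_sum => k _; apply: ler_wpM2l => //; rewrite !entryE wqE.
  by have := q'0' k; lra.
have wb a c : b ^+ m * w c 0 <= w a 0.
  rewrite -[X in b ^+ X]card_ord.
  apply: (connect_decay (f := fun a => w a 0) _ _ _ (M_irr a c)) => //.
    by lra.
  move=> x y /= /A_edge bA; rewrite [leRHS]wE [(A *m w) x 0]mxE (bigD1 y) //= addrCA.
  apply: (@le_trans _ _ (A x y * w y 0)); first exact: ler_wpM2r.
  rewrite lerDl addr_ge0 //; apply: sumr_ge0 => k _; exact: mulr_ge0.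
have ub a : b ^+ m * u a 0 <= u i0 0.
  apply: (cone_ratio (A := M^T)) => //; first by lra.
  - by move=> x y; rewrite [leRHS]mxE zeromx_entry; have := M_ge0 y x; rewrite mxE.
  - by move=> x y; rewrite mxE; apply: M_edge.
  - exact: irreducible_mx_tr.
  - by move=> x y; rewrite zeromx_entry (ord1 y) ltW.
pose G a := \sum_c \sum_k H a c k * w k 0 * w c 0.
have G0 a : 0 <= G a.
  by apply: sumr_ge0 => c _; apply: sumr_ge0 => k _; rewrite !mulr_ge0.
have wG a : w a 0 <= D a 0 + (M *m w) a 0 - 2^-1 * G a.
  rewrite {1}wE -addrA lerD2l !mxE /G mulr_sumr -sumrB; apply: ler_sum => c _.
  rewrite AE mxE -mulr_suml mulrA -mulrBl; apply: ler_wpM2r => //.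
  rewrite -addrA lerD ?L1_le // mulr_sumr -sumrB le_eqVlt; apply/orP; left.
  by apply/eqP; apply: eq_bigr => k _; ring.
have uM : \sum_a u a 0 * (M *m w) a 0 <= \sum_a u a 0 * w a 0.
  have -> : \sum_a u a 0 * (M *m w) a 0 = \sum_c (M^T *m u) c 0 * w c 0.
    under eq_bigr do rewrite mxE mulr_sumr.
    under [RHS]eq_bigr do rewrite mxE mulr_suml.
    rewrite exchange_big /=; apply: eq_bigr => c _; apply: eq_bigr => a _.
    by rewrite [M^T _ _]mxE; ring.
  by apply: ler_sum => c _; apply: ler_wpM2r => //; apply: Mu.
have uG : 2^-1 * (u i0 0 * G i0) <= Dm * \sum_a u a 0.
  have : \sum_a u a 0 * w a 0 <=
      \sum_a (u a 0 * D a 0 + u a 0 * (M *m w) a 0 - 2^-1 * (u a 0 * G a)).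
    apply: ler_sum => a _.
    have -> : u a 0 * D a 0 + u a 0 * (M *m w) a 0 - 2^-1 * (u a 0 * G a)
        = u a 0 * (D a 0 + (M *m w) a 0 - 2^-1 * G a) by ring.
    by apply: ler_wpM2l; [apply: ltW|apply: wG].
  rewrite sumrB big_split /= -mulr_sumr.
  have : \sum_a u a 0 * D a 0 <= Dm * \sum_a u a 0.
    rewrite mulr_sumr; apply: ler_sum => a _; rewrite mulrC.
    by apply: ler_wpM2r; [apply: ltW|].
  have : u i0 0 * G i0 <= \sum_a u a 0 * G a.
    rewrite (bigD1 i0) //= lerDl; apply: sumr_ge0 => a _.
    by apply: mulr_ge0; [apply: ltW|].
  by move: uM; lra.
have Gw : cH * (b ^+ m * w i 0) ^+ 2 <= G i0.
  rewrite /G (bigD1 j0) //= (bigD1 k0) //= -addrA.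
  apply: (@le_trans _ _ (H i0 j0 k0 * w k0 0 * w j0 0)); last first.
    rewrite lerDl addr_ge0 //; apply: sumr_ge0 => ? _; first by rewrite !mulr_ge0.
    by apply: sumr_ge0 => ? _; rewrite !mulr_ge0.
  have bw0 : 0 <= b ^+ m * w i 0 by rewrite mulr_ge0 // exprn_ge0 // ltW.
  by rewrite expr2 mulrA !ler_pM // mulr_ge0.
have Dm0 : 0 <= Dm by apply: le_trans (DDm i0).
have Su : b ^+ m * \sum_a u a 0 <= m%:R * u i0 0.
  rewrite mulr_sumr; apply: le_trans (ler_sum _ (fun a _ => ub a)) _.
  by rewrite sumr_const card_ord mulr_natl.
(* The exponent 3 m: one [b ^+ m] compares the entries of u with u_i0, two more compare w_j0 and
   w_k0 with w_i. *)
rewrite -(ler_pM2l (u0 i0)).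
have bm0 : 0 <= b ^+ m by rewrite exprn_ge0 // ltW.
have -> : u i0 0 * (cH * b ^+ (3 * m) * (q i 0 - q' i 0) ^+ 2)
    = b ^+ m * (u i0 0 * (cH * (b ^+ m * w i 0) ^+ 2)).
  by rewrite wqE [(3 * m)%N]mulnC exprM; ring.
apply: (@le_trans _ _ (b ^+ m * (u i0 0 * G i0))).
  by apply: ler_wpM2l => //; apply: ler_wpM2l => //; apply: ltW.
apply: (@le_trans _ _ (b ^+ m * (2 * (Dm * \sum_a u a 0)))).
  by apply: ler_wpM2l => //; move: uG; lra.
have -> : b ^+ m * (2 * (Dm * \sum_a u a 0)) = 2 * Dm * (b ^+ m * \sum_a u a 0).
  by ring.
have -> : u i0 0 * (2 * m%:R * Dm) = 2 * Dm * (m%:R * u i0 0) by ring.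
by apply: ler_wpM2l => //; apply: mulr_ge0.
Qed.

(** [W] is the perturbation error q - q', and the rest is the Newton error q' - x. Existence of x
    stands outside the quantitative hypotheses, as it is also needed when the error below is too
    large for them. *)
Lemma rnm_nonlinear_bound g :
  exists2 x, rnm h g P = Some x & [/\ lemx 0 x, lemx x q &
    forall U cH Dm : R, (forall i, q i 0 <= U) ->
      (forall i j, 0 < M i j -> b <= J1 (2^-1 *: q) i j) ->
      0 <= cH <= H i0 j0 k0 -> (forall i, (q - F1 q) i 0 <= Dm) ->
      forall i, exists W : R, [/\ 0 <= W,
        cH * b ^+ (3 * m) * W ^+ 2 <= 2 * m%:R * Dm &
        b ^+ m * (q i 0 - x i 0 - W) <= U / 2 ^+ g + 2 * 2 ^ (- h)]].
Proof.
have [v v0 Mv] := scc_cone.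
have [q' [q'0 q'q q'fix]] := scc_fixpoint.
have /andP[b0 b1] := b01.
have bm0 : 0 < b ^+ m by rewrite exprn_gt0.
have vb i j : b ^+ m * v i 0 <= v j 0.
  apply: (cone_ratio (A := M)) => //; first by lra.
  by move=> x y; rewrite zeromx_entry (ord1 y) ltW.
have run (U : R) i : (forall i, q i 0 <= U) -> exists2 x, rnm h g P = Some x &
    [/\ lemx 0 x, forall i, x i 0 < q i 0 &
        b ^+ m * (q' i 0 - x i 0) <= U / 2 ^+ g + 2 * 2 ^ (- h)].
  (* Scaled so that s v >= 1 everywhere, which makes U s and 2^-h s admissible factors, while b^m s
     v_i = 1 removes v from the estimate at i. *)
  move=> qU; pose s := (b ^+ m * v i 0)^-1.
  have s0 : 0 < s by rewrite invr_gt0 mulr_gt0.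
  have sv j : 1 <= s * v j 0.
    by rewrite mulrC ler_pdivlMr ?mulr_gt0 // mul1r.
  have U0 : 0 <= U by apply: le_trans (qU i); apply: ltW.
  have h0 : (0 : R) <= 2 ^ (- h) by apply: exprz_ge0.
  have [||||x xE [x0 xq _ xs]] := @rnm_nonlinear v q' (U * s) (2 ^ (- h) * s) g
    v0 Mv q'0 q'q q'fix.
  - by rewrite mulr_ge0 // ltW.
  - by rewrite mulr_ge0 // ltW.
  - move=> j; rewrite -mulrA; apply: le_trans (q'q j 0) _; apply: le_trans (qU j) _.
    by apply: ler_peMr.
  - by move=> j; rewrite -mulrA; apply: ler_peMr.
  exists x => //; split=> //.
  have := xs i; rewrite -(ler_pM2l bm0) => /le_trans; apply.
  rewrite le_eqVlt; apply/orP; left; apply/eqP; rewrite /s.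
  have v1 : v i 0 != 0 by rewrite gt_eqF.
  have b1' : b ^+ m != 0 by rewrite gt_eqF.
  have g1 : (2 : R) ^+ g != 0 by rewrite expf_eq0 pnatr_eq0 andbF.
  by field; rewrite v1 b1' g1.
pose Umax := \sum_j q j 0.
have qUmax i : q i 0 <= Umax.
  by rewrite /Umax (bigD1 i) //= lerDl; apply: sumr_ge0 => j _; apply: ltW.
(* [rnm h g P] is one fixed value, so a run with the bound [Umax] provides x, and reruns with other
   [U] and [i] give further estimates for the same x. *)
have [x xE [x0 xq _]] := run Umax i0 qUmax.
exists x => //; split=> //; first by move=> i j; rewrite (ord1 j) ltW.
move=> U cH Dm qU half cHb DDm i; exists (q i 0 - q' i 0); split.
- by rewrite subr_ge0; apply: q'q.
- exact: perturbation_nonlinear.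
have [y yE [_ _]] := run U i qU; move: yE; rewrite xE => -[<-] le_x.
by apply: le_trans le_x; apply: ler_wpM2l; [apply: ltW|lra].
Qed.

End Nonlinear.

(** * One Newton step in a linear SCC *)

Section Linear.
Hypothesis H_eq0 : forall i j k, H i j k = 0.

Let qjac_const L x : qjac L H x = L.
Proof.
apply/matrixP => i j; rewrite mxE big1 ?addr0 // => k _.
by rewrite H_eq0 mul0r.
Qed.

(** For an affine map one unrounded Newton step is exact, so z = q - N solves z - L1 z = D, and z -
    M z <= D gives z <= G D with G = (I - M)^-1. From c0 = q - M q and a positive constant c0_k >=
    gam follows G_ik gam <= q_i <= U; the other entries in the row of G cost a factor b^-m. *)
Lemma rnm_linear_bound (i0 : 'I_m) :
  exists2 x, rnm h 1 P = Some x & [/\ lemx 0 x, lemx x q &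
    forall U gam Dm : R, (forall i, q i 0 <= U) ->
      0 <= gam -> (forall k, 0 < c0 k 0 -> gam <= c0 k 0) ->
      (forall i, (q - F1 q) i 0 <= Dm) ->
      forall i, gam * b ^+ m * (q i 0 - x i 0 - 2 ^ (- h)) <= m%:R * U * Dm].
Proof.
have Mq : c0 = q - M *m q.
  move: q_fix; rewrite /qmap -/M {1 2}/M qjac_const -mulr2n -scaler_nat -scalemxAl.
  rewrite scalerA mulVf ?pnatr_eq0 // scale1r => E.
  by rewrite -{1}E addrK.
(* If all constants were nonpositive, 0 would be a prefixed point above the positive vector q. The
   index k serves as the strict row. *)
have [k ck] : exists k, 0 < c0 k 0.
  apply/existsP; apply: contraT; rewrite negb_exists => /forallP nc; exfalso.
  have := q_least (x := 0); rewrite qmap0 => /(_ (lemx_refl _)) qle.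
  have /qle/(_ i0 0) : lemx c0 0.
    by move=> i j; rewrite zeromx_entry (ord1 j) leNgt.
  by rewrite zeromx_entry leNgt q_gt0.
have Mqk : (M *m q) k 0 < q k 0.
  by move: ck; rewrite Mq !entryE subr_gt0.
have c0_ge0 i : 0 <= c0 i 0.
  by apply: le_trans (c1_le i 0); have := c1_ge0 i 0; rewrite zeromx_entry.
have Mq_le : lemx (M *m q) q.
  move=> i j; rewrite (ord1 j) -subr_ge0; have := c0_ge0 i.
  by rewrite Mq !entryE.
have J1E x : J1 x = L1 by apply: qjac_const.
have ME : M = L0 by apply: qjac_const.
have L1M : lemx L1 M by rewrite ME.
have posM : inverse_positive (1%:M - M).
  exact: inverse_positive_sub1 M_ge0 (lemx_refl _) M_irr q_gt0 Mq_le Mqk.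
have pos1 : inverse_positive (1%:M - J1 0).
  rewrite J1E; apply: (inverse_positive_sub1 L1_ge0 L1M M_irr q_gt0 Mq_le (k := k)).
  apply: le_lt_trans Mqk.
  exact: (lemx_mul L1_ge0 L1M q_ge0 (lemx_refl q)).
have [N NE res] := newton_residual pos1.
have [z zdef] : exists z, z = q - N by exists (q - N).
have zE : z - L1 *m z = D.
  have := res q; rewrite -zdef !J1E subrr mul0mx scaler0 addr0 mulmx1BE.
  by move=> ->.
have z0 i : 0 <= z i 0.
  have := pos1 z; rewrite J1E mulmx1BE zE => Hz.
  have := Hz _ i 0; rewrite zeromx_entry; apply=> a c.
  by rewrite (ord1 c) zeromx_entry.
have Nq i : N i 0 <= q i 0.
  by have := z0 i; rewrite zdef !entryE subr_ge0.
have rE i : map_mx (round_down h) N i 0 = round_down h (N i 0) by rewrite mxE.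
exists (map_mx (round_down h) N); first by rewrite /rnm /= /rnm_step NE.
split.
- by move=> i j; rewrite (ord1 j) rE zeromx_entry round_down_ge0.
- move=> i j; rewrite (ord1 j) rE; apply: le_trans (round_down_le _ _) _.
  by rewrite ge_max Nq ltW.
move=> U gam Dm qU gam0 gamc DDm i; rewrite rE.
have /andP[b0 b1] := b01.
have bm0 : 0 <= b ^+ m by rewrite exprn_ge0 // ltW.
pose G := invmx (1%:M - M).
have uM := inverse_positive_unit posM.
have G0 a c : 0 <= G a c.
  by have := inverse_positive_invmx posM a c; rewrite zeromx_entry.
have GE (y : 'cV[R]_m) : y i 0 = \sum_j G i j * (y - M *m y) j 0.
  by rewrite -{1}(mulKmx uM y) mulmx1BE mxE.
(* From G = I + G M, every row of G is a left subinvariant vector of M. *)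
have Gb a c : b ^+ m * G i c <= G i a.
  pose w : 'cV[R]_m := (row i G)^T.
  have wE j : w j 0 = G i j by rewrite !mxE.
  rewrite -!wE; apply: (cone_ratio (A := M^T)) => //; first by lra.
  - by move=> x y; rewrite [leRHS]mxE zeromx_entry; have := M_ge0 y x; rewrite mxE.
  - by move=> x y; rewrite mxE; apply: M_edge.
  - exact: irreducible_mx_tr.
  - by move=> x y; rewrite zeromx_entry (ord1 y) wE.
  move=> x y; rewrite (ord1 y) wE.
  have /matrixP/(_ i x) := mulVmx uM; rewrite -/G mulmxBr mulmx1 addmx_entry.
  rewrite oppmx_entry [RHS]mxE.
  have -> : (M^T *m w) x 0 = (G *m M) i x.
    by rewrite !mxE; apply: eq_bigr => l _; rewrite !mxE mulrC.
  have : 0 <= ((i == x)%:R : R) by apply: ler0n.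
  by move: (G i x) ((G *m M) i x) => ? ?; lra.
have Dm0 : 0 <= Dm by apply: le_trans (DDm i).
have zi : z i 0 <= Dm * \sum_j G i j.
  rewrite (GE z) mulr_sumr; apply: ler_sum => j _; rewrite [leRHS]mulrC.
  apply: ler_wpM2l => //; apply: le_trans (DDm j); rewrite -/D -zE.
  rewrite !addmx_entry !oppmx_entry lerD2l lerN2.
  have z0' : lemx 0 z by move=> a c; rewrite (ord1 c) zeromx_entry.
  exact: (lemx_mul L1_ge0 L1M z0' (lemx_refl z)).
have GU : G i k * gam <= U.
  apply: le_trans (qU i); rewrite (GE q) -Mq (bigD1 k) //=.
  apply: (@le_trans _ _ (G i k * c0 k 0)).
    by apply: ler_wpM2l => //; apply: gamc.
  by rewrite lerDl; apply: sumr_ge0 => j _; apply: mulr_ge0.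
have SG : b ^+ m * \sum_j G i j <= m%:R * G i k.
  rewrite mulr_sumr; apply: le_trans (ler_sum _ (fun a _ => Gb k a)) _.
  by rewrite sumr_const card_ord mulr_natl.
apply: (@le_trans _ _ (gam * b ^+ m * z i 0)).
  apply: ler_wpM2l; first exact: mulr_ge0.
  by have := round_down_gt h (N i 0); rewrite zdef !entryE; lra.
apply: (@le_trans _ _ (gam * b ^+ m * (Dm * \sum_j G i j))).
  by apply: ler_wpM2l => //; apply: mulr_ge0.
have -> : gam * b ^+ m * (Dm * \sum_j G i j)
    = gam * Dm * (b ^+ m * \sum_j G i j) by ring.
apply: (@le_trans _ _ (gam * Dm * (m%:R * G i k))).
  by apply: ler_wpM2l => //; apply: mulr_ge0.
have -> : gam * Dm * (m%:R * G i k) = (m%:R * Dm) * (G i k * gam) by ring.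
have -> : m%:R * U * Dm = (m%:R * Dm) * U by ring.
by apply: ler_wpM2l => //; apply: mulr_ge0.
Qed.

End Linear.
End SccStep.

(** * Quadratic polynomial systems *)

Section MpolyInduction.
Variables (R : comNzRingType) (n : nat) (Pr : {mpoly R[n]} -> Prop).
Hypothesis PrD : forall p q, Pr p -> Pr q -> Pr (p + q).
Hypothesis PrZ : forall c p, Pr p -> Pr (c *: p).
Hypothesis Pr1 : Pr 1.

Let Pr0 : Pr 0.
Proof. by rewrite -(scale0r 1); apply: PrZ. Qed.

Lemma mpoly_span_ind p : (forall m, m \in msupp p -> Pr 'X_[m]) -> Pr p.
Proof.
move=> PrX; rewrite [p]mpolyE big_seq; apply: big_ind => // m mp.
by apply: PrZ; apply: PrX.
Qed.

Lemma mpoly_alg_ind :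
  (forall p q, Pr p -> Pr q -> Pr (p * q)) -> (forall i, Pr 'X_i) ->
  forall p, Pr p.
Proof.
move=> PrM PrX p; apply: mpoly_span_ind => m _.
rewrite mpolyXE_id; apply: big_ind => // i _.
by elim: (m i) => [|k IHk]; rewrite ?expr0 ?exprS //; apply: PrM.
Qed.

Lemma mnm_decomp (m : 'X_{1..n}) (i : 'I_n) :
  (0 < m i)%N -> exists2 m', m = (U_(i) + m')%MM & mdeg m = (mdeg m').+1.
Proof.
move=> mi; exists (m - U_(i))%MM.
  by rewrite addmC submK //; apply/mnm_lepP => j; rewrite mnm1E; case: eqP => // <-.
rewrite -[in LHS](@submK _ U_(i) m); first by rewrite mdegD mdeg1 addn1.
by apply/mnm_lepP => j; rewrite mnm1E; case: eqP => // <-.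
Qed.

Lemma mdeg_gt0_mnm (m : 'X_{1..n}) : (0 < mdeg m)%N -> exists i, (0 < m i)%N.
Proof.
move=> m0; apply/existsP; apply: contraTT m0; rewrite negb_exists => /forallP m0.
by rewrite mdegE big1 // => i _; apply/eqP; have := m0 i; rewrite -eqn0Ngt.
Qed.

(** Only the monomials 1, X_i and X_i X_j remain, so a linear identity for quadratic polynomials
    needs checking on these alone. *)
Lemma mpoly_quad_ind :
  (forall i, Pr 'X_i) -> (forall i j, Pr ('X_i * 'X_j)) ->
  forall p, (msize p <= 3)%N -> Pr p.
Proof.
move=> PrX PrXX p sp; apply: mpoly_span_ind => m mp.
have dm : (mdeg m < 3)%N by apply: leq_trans (msize_mdeg_lt mp) sp.
have [->|m_neq0] := eqVneq m 0%MM; first by rewrite mpolyX0.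
have [|i mi] := @mdeg_gt0_mnm m; first by rewrite lt0n mdeg_eq0.
have [m' mE dE] := mnm_decomp mi.
rewrite mE; have [->|m'_neq0] := eqVneq m' 0%MM; first by rewrite addm0.
have /mdeg1P[j /eqP ->] : mdeg m' == 1%N.
  have m'0 : (0 < mdeg m')%N by rewrite lt0n mdeg_eq0.
  by rewrite eqn_leq m'0 andbT; move: dm; rewrite dE !ltnS.
by rewrite mpolyXD.
Qed.

End MpolyInduction.

Definition grad0 (R : realType) n (p : {mpoly R[n]}) j := (p^`M(j))@_0%MM.
Definition hess0 (R : realType) n (p : {mpoly R[n]}) j k :=
  (p^`M(j)^`M(k))@_0%MM.

Section QuadraticPoly.
Variables (R : realType) (n : nat).
Implicit Types (p : {mpoly R[n]}) (x : 'I_n -> R).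

Lemma mderivXU i j : ('X_i : {mpoly R[n]})^`M(j) = (i == j)%:R%:MP.
Proof.
rewrite mderivX mnm1E; case: eqP => [->|_]; last by rewrite scale0r mpolyC0.
have -> : (U_(j) - U_(j))%MM = (0 : 'X_{1..n})%MM.
  by apply/mnmP => k; rewrite mnmBE mnm0E subnn.
by rewrite mpolyX0 scale1r mpolyC1.
Qed.

Lemma grad0E p j : grad0 p j = p@_U_(j).
Proof. by rewrite /grad0 mcoeff_deriv mnm0E add0m. Qed.

Lemma hess0E p j k : hess0 p j k = p@_(U_(j) + U_(k)) *+ (1 + (j == k)).
Proof.
rewrite /hess0 !mcoeff_deriv mnm0E add0m mulr1n mnm1E eq_sym addmC.
by rewrite add1n.
Qed.

Lemma hess0C p j k : hess0 p j k = hess0 p k j.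
Proof. by rewrite !hess0E addmC eq_sym. Qed.

Lemma mderiv2_const p j k : (msize p <= 3)%N ->
  p^`M(j)^`M(k) = (hess0 p j k)%:MP.
Proof.
move=> sp; apply/mpolyP => m; rewrite mcoeffC.
have [->|m0] := eqVneq m 0%MM; first by rewrite mulr1.
rewrite mulr0 !mcoeff_deriv; have -> : p@_(m + U_(k) + U_(j)) = 0.
  apply/eqP; rewrite mcoeff_eq0; apply: msize_mdeg_ge.
  rewrite !mdegD !mdeg1 !addn1; apply: leq_trans sp _.
  by rewrite !ltnS lt0n mdeg_eq0.
by rewrite !mul0rn.
Qed.

Lemma grad0XX i i' j : grad0 ('X_i * 'X_i' : {mpoly R[n]}) j = 0.
Proof.
rewrite grad0E -mpolyXD mcoeffX; case: eqP => // /(congr1 mdeg).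
by rewrite mdegD !mdeg1.
Qed.

Lemma hess0XX i i' j k : hess0 ('X_i * 'X_i' : {mpoly R[n]}) j k
  = (i == j)%:R * (i' == k)%:R + (i == k)%:R * (i' == j)%:R.
Proof.
rewrite /hess0 mderivM !mderivXU mderivD !mderivM !mderivC !mderivXU mul0r mulr0.
by rewrite add0r addr0 -!mpolyCM mcoeffD !mcoeffC eqxx !mulr1.
Qed.

Lemma quad_deriv_eval p x j : (msize p <= 3)%N ->
  (p^`M(j)).@[x] = grad0 p j + \sum_k hess0 p j k * x k.
Proof.
move: p; apply: mpoly_quad_ind.
- move=> p q IHp IHq; rewrite mderivD mevalD IHp IHq /grad0 /hess0.
  rewrite mderivD mcoeffD addrACA; congr (_ + _); rewrite -big_split /=.
  by apply: eq_bigr => k _; rewrite mderivD mcoeffD mulrDl.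
- move=> c p IHp; rewrite mderivZ mevalZ IHp /grad0 /hess0.
  rewrite mderivZ mcoeffZ mulrDr mulr_sumr; congr (_ + _).
  by apply: eq_bigr => k _; rewrite mderivZ mcoeffZ mulrA.
- rewrite /grad0 /hess0 -mpolyC1 mderivC meval0 mcoeff0 big1 ?addr0 // => k _.
  by rewrite mderiv0 mcoeff0 mul0r.
- move=> i; rewrite /grad0 /hess0 mderivXU mevalC mcoeffC eqxx mulr1 big1 ?addr0 // => k _.
  by rewrite mderivC mcoeff0 mul0r.
move=> i i'; rewrite grad0XX add0r mderivM !mderivXU mevalD !mevalM !mevalC.
rewrite !mevalXU; under eq_bigr do rewrite hess0XX mulrDl -!mulrA.
rewrite big_split /= -mulr_sumr [in RHS](bigD1 i') //= eqxx mul1r big1 ?addr0; last first.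
  by move=> k /negPf; rewrite eq_sym => ->; rewrite mul0r.
rewrite [in RHS](bigD1 i) //= eqxx mul1r big1 ?addr0; last first.
  by move=> k /negPf; rewrite eq_sym => ->; rewrite mul0r.
by rewrite [_ * x i]mulrC.
Qed.

(** The trapezoidal rule along the segment from 0 to x; it puts a polynomial in the shape of
    [qmap]. *)
Lemma quad_eval p x : (msize p <= 3)%N ->
  p.@[x] = p@_0%MM + 2^-1 * \sum_j (grad0 p j + (p^`M(j)).@[x]) * x j.
Proof.
have deltaE (a : R) i : \sum_j a * (i == j)%:R * x j = a * x i.
  rewrite (bigD1 i) //= eqxx mulr1 big1 ?addr0 // => j /negPf.
  by rewrite eq_sym => ->; rewrite mulr0 mul0r.
have half (a : R) : a = 2^-1 * (a + a) by field.
move: p; apply: mpoly_quad_ind.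
- move=> p q IHp IHq; rewrite mevalD mcoeffD IHp IHq addrACA -mulrDr.
  rewrite -big_split /=; congr (_ + _ * _); apply: eq_bigr => j _.
  by rewrite /grad0 mderivD mcoeffD mevalD; ring.
- move=> c p IHp; rewrite mevalZ mcoeffZ IHp mulrDr mulrCA mulr_sumr.
  congr (_ + _ * _); apply: eq_bigr => j _.
  by rewrite /grad0 mderivZ mcoeffZ mevalZ; ring.
- rewrite meval1 mcoeff1 eqxx big1 ?mulr0 ?addr0 // => j _.
  by rewrite /grad0 -mpolyC1 mderivC mcoeff0 meval0 addr0 mul0r.
- move=> i; rewrite mevalXU mcoeffX; have -> : ((U_(i))%MM == 0%MM :> 'X_{1..n}) = false.
    by rewrite -mdeg_eq0 mdeg1.
  rewrite add0r; under eq_bigr do rewrite /grad0 mderivXU mevalC mcoeffC eqxx mulr1 mulrDl.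
  have d1 : \sum_j (i == j)%:R * x j = x i.
    by rewrite -[RHS]mul1r -deltaE; apply: eq_bigr => j _; rewrite mul1r.
  by rewrite big_split /= d1 -half.
move=> i i'; rewrite mevalM !mevalXU -mpolyXD mcoeffX.
have -> : ((U_(i) + U_(i'))%MM == 0%MM :> 'X_{1..n}) = false.
  by rewrite -mdeg_eq0 mdegD !mdeg1.
rewrite mpolyXD add0r.
under eq_bigr do rewrite grad0XX add0r mderivM !mderivXU mevalD !mevalM !mevalC
  !mevalXU mulrDl [_ * x i']mulrC.
by rewrite big_split /= !deltaE [x i' * x i]mulrC -half.
Qed.

Lemma grad0_ge0 p j : (forall m, 0 <= p@_m) -> 0 <= grad0 p j.
Proof. by rewrite grad0E. Qed.

Lemma hess0_ge0 p j k : (forall m, 0 <= p@_m) -> 0 <= hess0 p j k.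
Proof. by move=> p0; rewrite hess0E mulrn_wge0. Qed.

Lemma grad0_least p (cm : R) j : (forall m, 0 < p@_m -> cm <= p@_m) ->
  0 < grad0 p j -> cm <= grad0 p j.
Proof. by rewrite grad0E => pc; apply: pc. Qed.

Lemma hess0_least p (cm : R) j k : (forall m, 0 < p@_m -> cm <= p@_m) ->
  0 < hess0 p j k -> cm <= hess0 p j k.
Proof.
move=> pc; rewrite hess0E; case: (j == k); last by rewrite addn0; apply: pc.
rewrite pmulrn_lgt0 // => pp; apply: le_trans (pc _ pp) _.
by rewrite mulr2n lerDl ltW.
Qed.

(** A positive value needs a positive monomial. No variable of value 0 occurs in it, and its degree
    is at most 2. Zero values are allowed because the variables of an SCC are set to 0 to obtain its
    constant terms. *)
Lemma meval_least p (cm mu : R) x : (msize p <= 3)%N -> 0 <= cm -> 0 < mu <= 1 ->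
  (forall m, 0 <= p@_m) -> (forall m, 0 < p@_m -> cm <= p@_m) ->
  (forall i, x i = 0 \/ mu <= x i) -> 0 < p.@[x] -> cm * mu ^+ 2 <= p.@[x].
Proof.
move=> sp cm0 /andP[mu0 mu1] p0 pc xmu; rewrite mevalE.
have x0 i : 0 <= x i by case: (xmu i) => [->//|]; apply: le_trans; apply: ltW.
have t0 m : 0 <= p@_m * \prod_i x i ^+ m i.
  by rewrite mulr_ge0 // prodr_ge0 // => i _; rewrite exprn_ge0.
move=> sum0.
have [m mp tm] : exists2 m, m \in msupp p & 0 < p@_m * \prod_i x i ^+ m i.
  apply/hasP; apply: contraLR sum0; rewrite -leNgt => /hasPn no.
  rewrite big_seq big1 // => m /no; rewrite -leNgt => le0.
  by apply/eqP; rewrite eq_le le0 t0.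
apply: (@le_trans _ _ (p@_m * \prod_i x i ^+ m i)); last first.
  by rewrite (bigD1_seq m) //= lerDl; apply: sumr_ge0.
have pm : 0 < p@_m.
  by rewrite lt_neqAle p0 andbT; apply: contraTneq tm => <-; rewrite mul0r ltxx.
have prod0 : 0 < \prod_i x i ^+ m i by rewrite -(pmulr_rgt0 _ pm).
apply: ler_pM => //; [by rewrite exprn_ge0 // ltW|exact: pc|].
apply: (@le_trans _ _ (mu ^+ mdeg m)).
  apply: ler_wiXn2l => //; first exact: ltW.
  by rewrite -ltnS; apply: leq_trans (msize_mdeg_lt mp) sp.
rewrite mdegE expr_sum; apply: ler_prod => i _.
rewrite exprn_ge0 /=; last exact: ltW.
case: (xmu i) => [xi|]; last by move=> ?; apply: lerXn2r; rewrite ?nnegrE ?x0 // ltW.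
have [->|mi] := posnP (m i); first by rewrite !expr0.
by move: prod0; rewrite (bigD1 i) //= xi expr0n (gtn_eqF mi) mul0r ltxx.
Qed.

End QuadraticPoly.

Definition cst_col (R : realType) n (Q : system R n) : 'cV[R]_n :=
  \col_i (Q i)@_0%MM.
Definition grad_mx (R : realType) n (Q : system R n) : 'M[R]_n :=
  \matrix_(i, j) grad0 (Q i) j.
Definition hess_mx (R : realType) n (Q : system R n) (i : 'I_n) : 'M[R]_n :=
  \matrix_(j, k) hess0 (Q i) j k.

Section QuadraticSystem.
Variables (R : realType) (n : nat) (Q : system R n).
Hypothesis Qmps : is_mps Q.
Hypothesis Qquad : quadratic Q.
Let L := grad_mx Q.
Let H := hess_mx Q.

Lemma jacobianE x : jacobian Q x = qjac L H x.
Proof.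
apply/matrixP => i j; rewrite !mxE quad_deriv_eval //; congr (_ + _).
by apply: eq_bigr => k _; rewrite mxE.
Qed.

Lemma eval_sysE x : eval_sys Q x = qmap (cst_col Q) L H x.
Proof.
apply/colP => i; rewrite /qmap -jacobianE !mxE quad_eval //; congr (_ + _ * _).
by apply: eq_bigr => j _; rewrite !mxE.
Qed.

Lemma grad_mx_ge0 : lemx 0 L.
Proof. by move=> i j; rewrite !mxE grad0_ge0. Qed.

Lemma hess_mx_ge0 i : lemx 0 (H i).
Proof. by move=> j k; rewrite !mxE hess0_ge0. Qed.

Lemma hess_mxC i j k : H i j k = H i k j.
Proof. by rewrite !mxE hess0C. Qed.

Lemma eval_sys_le x y : lemx 0 x -> lemx x y -> lemx (eval_sys Q x) (eval_sys Q y).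
Proof.
move=> x0 xy; rewrite !eval_sysE; apply: qmap_le => //; try exact: lemx_refl.
  exact: hess_mx_ge0.
exact: grad_mx_ge0.
Qed.

(** [is_lfp] compares only with fixed points; the box below a prefixed point contains one. *)
Lemma lfp_le_prefixed q x :
  is_lfp Q q -> lemx 0 x -> lemx (eval_sys Q x) x -> lemx q x.
Proof.
move=> [_ _ least] x0 Qx.
have [||s [s0 sx sE]] := @tarski_box _ _ (eval_sys Q) x x0 _ Qx.
- move=> i j; rewrite !mxE mevalE; apply: sumr_ge0 => m _; rewrite mulr_ge0 //.
  by apply: prodr_ge0 => k _; rewrite mxE exprn_ge0.
- exact: eval_sys_le.
move=> i j; rewrite (ord1 j); apply: le_trans (sx i 0); apply: least => // k.
by have := s0 k 0; rewrite mxE.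
Qed.

Lemma depP i j : reflect (0 < L i j \/ exists k, 0 < H i j k) (dep Q i j).
Proof.
have in_supp m : 0 < (Q i)@_m -> m \in msupp (Q i).
  by rewrite mcoeff_msupp => ?; rewrite gt_eqF.
apply: (iffP hasP) => [[m mQ /andP[Qm mj]]|].
  have dm : (mdeg m < 3)%N by apply: leq_trans (msize_mdeg_lt mQ) (Qquad i).
  have [m' mE dE] := mnm_decomp mj.
  have [m'0|m'_neq0] := eqVneq m' 0%MM.
    by left; rewrite mxE grad0E; move: Qm; rewrite mE m'0 addm0.
  right; have /mdeg1P[k /eqP m'E] : mdeg m' == 1%N.
    have m'0 : (0 < mdeg m')%N by rewrite lt0n mdeg_eq0.
    by rewrite eqn_leq m'0 andbT; move: dm; rewrite dE !ltnS.
  exists k; rewrite mxE hess0E; move: Qm; rewrite mE m'E => Qm.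
  by rewrite pmulrn_lgt0 // add1n.
case=> [|[k]]; rewrite mxE.
  rewrite grad0E => Qj; exists U_(j)%MM; first exact: in_supp.
  by rewrite Qj mnm1E eqxx.
rewrite hess0E pmulrn_lgt0 ?add1n // => Qjk; exists (U_(j) + U_(k))%MM.
  exact: in_supp.
by rewrite Qjk mnmDE mnm1E eqxx.
Qed.

Lemma jacobian_no_dep x i j : ~~ dep Q i j -> jacobian Q x i j = 0.
Proof.
move=> nd; rewrite jacobianE mxE.
have Lij : L i j = 0.
  apply/eqP; rewrite eq_le; apply/andP; split.
    by rewrite leNgt; apply: contra nd => ?; apply/depP; left.
  by have := grad_mx_ge0 i j; rewrite zeromx_entry.
rewrite Lij add0r big1 // => k _.
suff -> : H i j k = 0 by rewrite mul0r.
apply/eqP; rewrite eq_le; apply/andP; split.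
  by rewrite leNgt; apply: contra nd => ?; apply/depP; right; exists k.
by have := hess_mx_ge0 i j k; rewrite zeromx_entry.
Qed.

Lemma jacobian_ge0 x i j : lemx 0 x -> 0 <= jacobian Q x i j.
Proof.
move=> x0; have := qjac_ge0 hess_mx_ge0 grad_mx_ge0 x0 i j.
by rewrite -jacobianE zeromx_entry.
Qed.

Lemma jacobian_le x y i j :
  lemx x y -> jacobian Q x i j <= jacobian Q y i j.
Proof.
move=> xy; rewrite !jacobianE.
exact: (qjac_le hess_mx_ge0 (lemx_refl L) xy i j).
Qed.

Lemma eval_sys_sub x y i : eval_sys Q x i 0 - eval_sys Q y i 0
  = 2^-1 * \sum_j (jacobian Q x i j + jacobian Q y i j) * (x j 0 - y j 0).
Proof.
have := qmap_sub hess_mxC (cst_col Q) L x y; rewrite -!eval_sysE -!jacobianE.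
move=> /matrixP/(_ i 0); rewrite addmx_entry oppmx_entry => ->.
rewrite scalemx_entry mxE; congr (_ * _); apply: eq_bigr => j _.
by rewrite !entryE.
Qed.

(** Origin of b = cm mu: an edge comes from a linear monomial, contributing at least cm, or from a
    product with some x_k, contributing at least cm x_k. Such a k is itself a successor of i, so the
    lower bound on x is asked only there. *)
Lemma jacobian_edge (cm mu : R) x i j :
  0 <= cm -> 0 <= mu <= 1 -> (forall i m, 0 < (Q i)@_m -> cm <= (Q i)@_m) ->
  lemx 0 x -> (forall k, dep Q i k -> mu <= x k 0) ->
  dep Q i j -> cm * mu <= jacobian Q x i j.
Proof.
move=> cm0 /andP[mu0 mu1] Qc x0 xmu /depP dij.
have x0' k : 0 <= x k 0 by have := x0 k 0; rewrite zeromx_entry.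
have L0 : 0 <= L i j by have := grad_mx_ge0 i j; rewrite zeromx_entry.
have H0 k : 0 <= H i j k by have := hess_mx_ge0 i j k; rewrite zeromx_entry.
rewrite jacobianE mxE; case: dij => [Lij|[k Hijk]].
  apply: (@le_trans _ _ (L i j)).
    apply: (@le_trans _ _ cm); first by rewrite ler_piMr.
    by move: Lij; rewrite mxE; apply: grad0_least; apply: Qc.
  by rewrite lerDl; apply: sumr_ge0 => l _; apply: mulr_ge0.
rewrite (bigD1 k) //= addrCA; apply: (@le_trans _ _ (H i j k * x k 0)).
  apply: ler_pM => //.
    by move: Hijk; rewrite mxE; apply: hess0_least; apply: Qc.
  by apply: xmu; apply/depP; right; exists j; rewrite hess_mxC.
rewrite lerDl addr_ge0 //; apply: sumr_ge0 => l _; exact: mulr_ge0.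
Qed.

(** The row sum of L + J(1) is twice Q(1) minus the constant term, and replacing 1 by x <= U costs
    at most a factor U. *)
Lemma jacobian_row_sum (U : R) x i : 1 <= U -> lemx 0 x ->
  (forall j, x j 0 <= U) ->
  \sum_j jacobian Q x i j <= 2 * U * eval_sys Q (const_mx 1) i 0.
Proof.
move=> U1 x0 xU; set o : 'cV[R]_n := const_mx 1.
have oE j : o j 0 = 1 by rewrite mxE.
rewrite eval_sysE /qmap -jacobianE.
rewrite addmx_entry scalemx_entry (mxE mulmx_key).
have c0 : 0 <= cst_col Q i 0 by rewrite mxE.
have L0 j : 0 <= L i j by have := grad_mx_ge0 i j; rewrite zeromx_entry.
have H0 j k : 0 <= H i j k by have := hess_mx_ge0 i j k; rewrite zeromx_entry.
apply: (@le_trans _ _ (2 * U *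
    (2^-1 * \sum_j (L + jacobian Q o) i j * o j 0))); last first.
  by apply: ler_wpM2l; [lra|rewrite lerDr].
rewrite !mulr_sumr; apply: ler_sum => j _; rewrite addmx_entry !jacobianE oE mulr1.
have -> : 2 * U * (2^-1 * (L i j + qjac L H o i j)) = U * L i j + U * qjac L H o i j.
  by field.
rewrite [qjac _ _ _ _ _]mxE [qjac _ _ o _ _]mxE.
have LU : L i j <= U * L i j by apply: ler_peMl.
have HU : \sum_k H i j k * x k 0 <= U * \sum_k H i j k * o k 0.
  rewrite mulr_sumr; apply: ler_sum => k _; rewrite oE mulr1 mulrC.
  by apply: ler_wpM2r.
have : 0 <= U * L i j by apply: mulr_ge0 => //; lra.
by lra.
Qed.

End QuadraticSystem.

(** * Restriction to an SCC *)

Definition restrict (R : realType) n (S : {set 'I_n}) (z : 'cV[R]_n) : 'cV[R]_#|S| :=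
  \col_l z (enum_val l) 0.

Section Update.
Variables (R : realType) (n : nat) (S : {set 'I_n}).
Implicit Types (z : 'cV[R]_n) (y : 'cV[R]_#|S|).

Lemma update_in z y l : update z y (enum_val l) 0 = y l 0.
Proof.
rewrite mxE; case: pickP => [l' /eqP/enum_val_inj -> //|/(_ l)].
by rewrite eqxx.
Qed.

Lemma update_out z y i : i \notin S -> update z y i 0 = z i 0.
Proof.
move=> iS; rewrite mxE; case: pickP => // l /eqP li.
by move: iS; rewrite -li enum_valP.
Qed.

Lemma enum_val_ex i : i \in S -> exists l : 'I_#|S|, i = enum_val l.
Proof. by move=> iS; exists (enum_rank_in iS i); rewrite enum_rankK_in. Qed.

Lemma update_ind (Pr : 'I_n -> R -> Prop) z y :
  (forall l, Pr (enum_val l) (y l 0)) -> (forall i, i \notin S -> Pr i (z i 0)) ->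
  forall i, Pr i (update z y i 0).
Proof.
move=> Pin Pout i; have [iS|iS] := boolP (i \in S).
  by have [l ->] := enum_val_ex iS; rewrite update_in.
by rewrite update_out //; apply: Pout.
Qed.

Lemma update_restrict z : update z (restrict S z) = z.
Proof.
apply/colP => i; apply: (@update_ind (fun i r => r = z i 0)) => // l.
by rewrite mxE.
Qed.

Lemma update_le z z' y y' : lemx z z' -> lemx y y' -> lemx (update z y) (update z' y').
Proof.
move=> zz yy i j; rewrite (ord1 j); have [iS|iS] := boolP (i \in S).
  by have [l ->] := enum_val_ex iS; rewrite !update_in; apply: yy.
by rewrite !update_out //; apply: zz.
Qed.

Lemma update_ge0 z y : lemx 0 z -> lemx 0 y -> lemx 0 (update z y).
Proof.
move=> z0 y0 i j; rewrite (ord1 j) zeromx_entry.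
apply: (@update_ind (fun _ r => 0 <= r)) => [l|k _].
  by have := y0 l 0; rewrite zeromx_entry.
by have := z0 k 0; rewrite zeromx_entry.
Qed.

Lemma sum_enum_val (f : 'I_n -> R) :
  (forall j, j \notin S -> f j = 0) -> \sum_j f j = \sum_(l < #|S|) f (enum_val l).
Proof.
move=> f0; rewrite (bigID (mem S)) /= [X in _ + X]big1 // addr0.
by rewrite big_enum_val.
Qed.

End Update.

Section SccSystem.
Variables (R : realType) (n : nat) (Q : system R n) (S : {set 'I_n}).
Hypothesis Qmps : is_mps Q.
Hypothesis Qquad : quadratic Q.
Implicit Types (z : 'cV[R]_n) (x : 'cV[R]_#|S|).

Let subst_tuple z : n.-tuple {mpoly R[#|S|]} :=
  [tuple if [pick l : 'I_#|S| | enum_val l == i] is Some l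
         then 'X_l else (z i 0)%:MP | i < n].

Let subst_eval z x i : (tnth (subst_tuple z) i).@[fun l => x l 0] = update z x i 0.
Proof. by rewrite tnth_mktuple mxE; case: pickP => *; rewrite ?mevalXU ?mevalC. Qed.

Lemma scc_system_eval z (p : {mpoly R[n]}) x :
  (p \mPo subst_tuple z).@[fun l => x l 0] = p.@[fun i => update z x i 0].
Proof. by rewrite comp_mpoly_meval; apply: meval_eq => i; apply: subst_eval. Qed.

Lemma scc_system_mderiv z (p : {mpoly R[n]}) l :
  (p \mPo subst_tuple z)^`M(l) = p^`M(enum_val l) \mPo subst_tuple z.
Proof.
move: p; apply: mpoly_alg_ind.
- by move=> p q IHp IHq; rewrite comp_mpolyD !mderivD comp_mpolyD IHp IHq.
- by move=> c p IHp; rewrite comp_mpolyZ !mderivZ comp_mpolyZ IHp.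
- by rewrite comp_mpoly1 -!mpolyC1 !mderivC comp_mpoly0.
- move=> p q IHp IHq; rewrite rmorphM /= !mderivM IHp IHq.
  by rewrite comp_mpolyD !rmorphM.
move=> i; rewrite mderivXU comp_mpolyC comp_mpolyXU -tnth_nth tnth_mktuple.
case: pickP => [l' /eqP <-|nl]; first by rewrite mderivXU (inj_eq enum_val_inj).
by rewrite mderivC eq_sym nl mpolyC0.
Qed.

(** The data of an SCC are read off the whole system at the point with zeros on [S], so their
    monotonicity in [z] is inherited. The Hessian does not involve [z], as the degree is at most
    2. *)
Definition scc_cst z : 'cV[R]_#|S| :=
  restrict S (eval_sys Q (update z (0 : 'cV[R]_#|S|))).
Definition scc_grad z : 'M[R]_#|S| :=
  \matrix_(k, l) jacobian Q (update z (0 : 'cV[R]_#|S|)) (enum_val k) (enum_val l).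
Definition scc_hess (k : 'I_#|S|) : 'M[R]_#|S| :=
  \matrix_(a, b) hess_mx Q (enum_val k) (enum_val a) (enum_val b).

Lemma scc_qjac z x k l :
  qjac (scc_grad z) scc_hess x k l
    = jacobian Q (update z x) (enum_val k) (enum_val l).
Proof.
rewrite !(jacobianE Qquad) mxE [scc_grad _ _ _]mxE (jacobianE Qquad).
rewrite ![qjac _ _ _ _ _]mxE -addrA.
congr (_ + _); have E y : \sum_j hess_mx Q (enum_val k) (enum_val l) j * update z y j 0
    = \sum_(j | j \notin S) hess_mx Q (enum_val k) (enum_val l) j * z j 0
      + \sum_a scc_hess k l a * y a 0.
  rewrite (bigID (mem S)) /= [LHS]addrC; congr (_ + _).
    by apply: eq_bigr => j jS; rewrite update_out.
  rewrite big_enum_val; apply: eq_bigr => a _.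
  by rewrite update_in [scc_hess _ _ _]mxE.
rewrite !E -addrA; congr (_ + _).
by rewrite big1 ?add0r // => a _; rewrite zeromx_entry mulr0.
Qed.

Lemma scc_qmap z x :
  qmap (scc_cst z) (scc_grad z) scc_hess x = restrict S (eval_sys Q (update z x)).
Proof.
apply/colP => k; rewrite [RHS]mxE /qmap addmx_entry scalemx_entry (mxE mulmx_key).
rewrite [scc_cst _ _ _]mxE; apply/eqP; rewrite addrC -subr_eq0 -addrA; apply/eqP.
have -> : eval_sys Q (update z x) (enum_val k) 0
    = eval_sys Q (update z (0 : 'cV[R]_#|S|)) (enum_val k) 0
      + (eval_sys Q (update z x) (enum_val k) 0
      - eval_sys Q (update z (0 : 'cV[R]_#|S|)) (enum_val k) 0) by ring.
rewrite eval_sys_sub // (@sum_enum_val _ _ S); last first.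
  by move=> j jS; rewrite !update_out // subrr mulr0.
rewrite [X in _ - (_ + _ * X)](eq_bigr (fun l =>
  (scc_grad z + qjac (scc_grad z) scc_hess x) k l * x l 0)); first by ring.
move=> l _; rewrite !update_in zeromx_entry subr0 addmx_entry scc_qjac.
by rewrite [scc_grad _ _ _]mxE [X in X * _]addrC.
Qed.

Lemma scc_jacobianE z x :
  jacobian (scc_system Q S z) x = qjac (scc_grad z) scc_hess x.
Proof.
apply/matrixP => k l; rewrite scc_qjac !mxE /scc_system scc_system_mderiv.
exact: scc_system_eval.
Qed.

Lemma scc_evalE z x :
  eval_sys (scc_system Q S z) x = qmap (scc_cst z) (scc_grad z) scc_hess x.
Proof.
by apply/colP => k; rewrite scc_qmap !mxE; apply: scc_system_eval.
Qed.

Lemma scc_hessC k a b : scc_hess k a b = scc_hess k b a.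
Proof. by rewrite !mxE hess0C. Qed.

Lemma scc_hess_ge0 k : lemx 0 (scc_hess k).
Proof. by move=> a b; rewrite !mxE hess0_ge0. Qed.

Lemma scc_mderiv2 z k a b :
  (scc_system Q S z k)^`M(a)^`M(b) = (scc_hess k a b)%:MP.
Proof.
rewrite /scc_system !scc_system_mderiv (mderiv2_const _ _ (Qquad _)) comp_mpolyC.
by rewrite !mxE.
Qed.

Lemma linear_scc_hess z : linear_scc Q z S -> forall k a b, scc_hess k a b = 0.
Proof.
move=> /forallP lin k a b; have := scc_mderiv2 z k a b.
move=> /(congr1 (mcoeff 0%MM)); rewrite mcoeffC eqxx mulr1 => <-.
rewrite !mcoeff_deriv; have -> : (scc_system Q S z k)@_(0 + U_(b) + U_(a)) = 0.
  apply/eqP; rewrite mcoeff_eq0; apply: msize_mdeg_ge.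
  by apply: leq_trans (lin k) _; rewrite !mdegD !mdeg1 mdeg0.
by rewrite !mul0rn.
Qed.

(** Differentiating twice along variables of the leading monomial leaves a nonzero coefficient.
    Since the Hessian is free of [z], the classification made at the exact solution also holds for
    the system with computed values. *)
Lemma nonlinear_scc_hess z :
  ~~ linear_scc Q z S -> exists k a b, 0 < scc_hess k a b.
Proof.
rewrite negb_forall => /existsP[k]; rewrite -ltnNge => sk.
set p := scc_system Q S z k in sk *.
have p0 : p != 0 by rewrite -msize_poly_eq0 -lt0n; apply: leq_ltn_trans sk.
have mp := mlead_supp p0; have dm := mlead_deg p0.
set m := mlead p in mp dm; rewrite -dm ltnS in sk.
have [|a ma] := @mdeg_gt0_mnm _ m; first by apply: leq_trans sk.
have [m1 mE d1] := mnm_decomp ma; rewrite d1 ltnS in sk.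
have [|b m1b] := @mdeg_gt0_mnm _ m1; first by apply: leq_trans sk.
have [m2 m1E _] := mnm_decomp m1b.
exists k, a, b; rewrite lt_neqAle; apply/andP; split; last first.
  by have := scc_hess_ge0 k a b; rewrite zeromx_entry.
apply/eqP => h0; have := scc_mderiv2 z k a b; rewrite -h0 mpolyC0 -/p.
move=> /(congr1 (mcoeff m2)) /eqP; rewrite mcoeff0 !mcoeff_deriv !mulrn_eq0 /=.
rewrite mcoeff_eq0; have -> : (m2 + U_(b) + U_(a))%MM = m.
  by rewrite mE m1E addmC [(m2 + _)%MM]addmC.
by rewrite mp.
Qed.

End SccSystem.

Arguments scc_cst {R n} Q S z.
Arguments scc_grad {R n} Q S z.
Arguments scc_hess {R n} Q S k.

(** * An SCC inside the whole system *)

Section ProcessScc.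
Variables (R : realType) (n : nat) (Q : system R n) (q : 'cV[R]_n).
Variables (U cm mu A : R).
Hypothesis Qmps : is_mps Q.
Hypothesis Qquad : quadratic Q.
Hypothesis q_lfp : is_lfp Q q.
Hypothesis q_gt0 : forall i, 0 < q i 0.
Hypothesis U_ge1 : 1 <= U.
Hypothesis q_le : forall i, q i 0 <= U.
Hypothesis cm01 : 0 < cm <= 1.
Hypothesis Q_cm : forall i m, 0 < (Q i)@_m -> cm <= (Q i)@_m.
Hypothesis mu01 : 0 < mu <= 1.
Hypothesis q_mu : forall i, 2 * mu <= q i 0.
Hypothesis Q1_le : forall i, eval_sys Q (const_mx 1) i 0 <= A.
Variables (S : {set 'I_n}) (z : 'cV[R]_n) (h : int) (g : nat).
Hypothesis S_scc : S \in sccs Q.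
Hypothesis z_ge0 : lemx 0 z.
Hypothesis z_le : lemx z q.

Let b := cm * mu.
Let qS := restrict S q.
Let H := scc_hess Q S.
Let M := qjac (scc_grad Q S q) H qS.

Let q_ge0 : lemx 0 q.
Proof. by move=> i j; rewrite zeromx_entry (ord1 j) ltW. Qed.

Let qS_ge0 : lemx 0 qS.
Proof. by move=> k j; rewrite !mxE ltW. Qed.

Let S0_ge0 : lemx 0 (0 : 'cV[R]_#|S|).
Proof. exact: lemx_refl. Qed.

Let M_jac k l : M k l = jacobian Q q (enum_val k) (enum_val l).
Proof. by rewrite /M scc_qjac // update_restrict. Qed.

Let q_fix : eval_sys Q q = q.
Proof. by case: q_lfp. Qed.

Let b01 : 0 < b <= 1.
Proof.
by move: cm01 mu01 => /andP[? ?] /andP[? ?]; rewrite mulr_gt0 //= mulr_ile1 // ltW.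
Qed.

Let jac_q_edge i j : dep Q i j -> b <= jacobian Q q i j.
Proof.
move: cm01 mu01 => /andP[cm0 _] /andP[mu0 mu1].
apply: (jacobian_edge Qmps Qquad _ _ Q_cm) => //; [exact: ltW|lra|].
by move=> k _; have := q_mu k; lra.
Qed.

Let M_pos_dep k l : (0 < M k l) = dep Q (enum_val k) (enum_val l).
Proof.
rewrite M_jac; apply/idP/idP => [|/jac_q_edge].
  by apply: contraTT => /(jacobian_no_dep Qmps Qquad) ->; rewrite ltxx.
by apply: lt_le_trans; case/andP: b01.
Qed.

Let M_edge k l : 0 < M k l -> b <= M k l.
Proof. by rewrite M_pos_dep M_jac; apply: jac_q_edge. Qed.

(** A path joining two vertices of [S] never leaves [S]: each vertex on it is reachable from i0 and
    reaches i0. *)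
Let M_irr : irreducible_mx M.
Proof.
have [i0 _ SE] := imsetP S_scc.
have inS i : (i \in S) = connect (dep Q) i0 i && connect (dep Q) i i0.
  by rewrite SE inE.
suff path_conn p a c : path (dep Q) (enum_val a) p ->
    last (enum_val a) p = enum_val c -> connect [rel x y | 0 < M x y] a c.
  move=> a c; have := enum_valP a; have := enum_valP c; rewrite !inS.
  move=> /andP[i0c _] /andP[_ ai0].
  by have /connectP[p pp lp] := connect_trans ai0 i0c; apply: (path_conn p).
elim: p a => [|k p IHp] a /=; first by move=> _ /enum_val_inj ->.
case/andP=> ak kp lp.
have kS : k \in S.
  have := enum_valP a; have := enum_valP c; rewrite !inS.
  move=> /andP[_ ci0] /andP[i0a _]; apply/andP; split.
    by apply: connect_trans i0a (connect1 ak).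
  by apply: connect_trans ci0; apply/connectP; exists p; rewrite ?lp.
have [l kE] := enum_val_ex kS; rewrite kE in ak kp lp.
by apply: connect_trans (connect1 _) (IHp l kp lp); rewrite /= M_pos_dep.
Qed.

Let scc_least x : lemx 0 x ->
  lemx (qmap (scc_cst Q S q) (scc_grad Q S q) H x) x -> lemx qS x.
Proof.
move=> x0; rewrite scc_qmap // => Fx.
(* Capping x at q keeps the rows outside [S] below q as well, so [update q y] is a prefixed point of
   the full system. *)
pose y : 'cV[R]_#|S| := \col_l Num.min (x l 0) (qS l 0).
have yE l : y l 0 = Num.min (x l 0) (qS l 0) by rewrite mxE.
have yx : lemx y x by move=> l j; rewrite (ord1 j) yE ge_min lexx.
have yq : lemx y qS by move=> l j; rewrite (ord1 j) yE ge_min lexx orbT.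
have y0 : lemx 0 y.
  move=> l j; rewrite (ord1 j) zeromx_entry yE le_min; apply/andP; split.
    by have := x0 l 0; rewrite zeromx_entry.
  by have := qS_ge0 l 0; rewrite zeromx_entry.
have Y0 : lemx 0 (update q y) by apply: update_ge0.
have Yq : lemx (update q y) q.
  by rewrite -[X in lemx _ X](update_restrict S); apply: update_le =>
    //; exact: lemx_refl.
have EY : lemx (eval_sys Q (update q y)) q.
  by rewrite -[X in lemx _ X]q_fix; apply: eval_sys_le.
have : lemx q (update q y).
  apply: lfp_le_prefixed => // i j; rewrite (ord1 j).
  have [iS|iS] := boolP (i \in S); last by rewrite update_out // EY.
  have [l ->] := enum_val_ex iS; rewrite update_in yE le_min; apply/andP; split.
    apply: le_trans (Fx l 0); rewrite [leRHS]mxE; apply: eval_sys_le => //.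
    by apply: update_le => //; exact: lemx_refl.
  by rewrite [qS _ _]mxE EY.
move=> qY l j; rewrite (ord1 j); apply: le_trans (yx l 0).
by have := qY (enum_val l) 0; rewrite update_in [qS l 0]mxE.
Qed.

Let qS_fix : qmap (scc_cst Q S q) (scc_grad Q S q) H qS = qS.
Proof. by rewrite scc_qmap // update_restrict q_fix. Qed.

Let cst_ge0 : lemx 0 (scc_cst Q S z).
Proof.
move=> k j; rewrite zeromx_entry !mxE mevalE; apply: sumr_ge0 => m _.
rewrite mulr_ge0 //; apply: prodr_ge0 => i _; apply: exprn_ge0.
by have := update_ge0 z_ge0 S0_ge0 i 0; rewrite zeromx_entry.
Qed.

Let cst_le : lemx (scc_cst Q S z) (scc_cst Q S q).
Proof.
move=> k j; rewrite [leLHS]mxE [leRHS]mxE; apply: eval_sys_le => //; first exact: update_ge0.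
by apply: update_le => //; exact: lemx_refl.
Qed.

Let grad_ge0 : lemx 0 (scc_grad Q S z).
Proof.
move=> k l; rewrite zeromx_entry mxE; apply: jacobian_ge0 => //.
exact: update_ge0.
Qed.

Let grad_le : lemx (scc_grad Q S z) (scc_grad Q S q).
Proof.
move=> k l; rewrite [leLHS]mxE [leRHS]mxE; apply: jacobian_le => //.
by apply: update_le => //; exact: lemx_refl.
Qed.

Let qS_gt0 k : 0 < qS k 0.
Proof. by rewrite mxE. Qed.

Let qS_le k : qS k 0 <= U.
Proof. by rewrite mxE. Qed.

(** The two points agree on [S], so only variables below [S] contribute, each at most e. Both
    Jacobians have row sums at most 2 U A, and the mean value formula averages them. *)
Let defect_le (e : R) : 0 <= e ->
  (forall i j, i \in S -> j \notin S -> dep Q i j -> q j 0 - z j 0 <= e) ->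
  forall k, (qS - qmap (scc_cst Q S z) (scc_grad Q S z) H qS) k 0 <= 2 * U * A * e.
Proof.
move=> e0 ze k; rewrite scc_qmap // addmx_entry oppmx_entry.
have -> : qS k 0 = eval_sys Q q (enum_val k) 0 by rewrite q_fix mxE.
rewrite [restrict S (eval_sys _ _) k 0]mxE eval_sys_sub //.
set i := enum_val k; set y := update z qS.
have y0 : lemx 0 y by apply: update_ge0.
have yq : lemx y q.
  rewrite -[X in lemx _ X](update_restrict S).
  exact: (update_le z_le (lemx_refl qS)).
apply: (@le_trans _ _ (2^-1 * \sum_j (jacobian Q q i j + jacobian Q y i j) * e)).
  apply: ler_wpM2l; first by rewrite invr_ge0.
  apply: ler_sum => j _; have [dij|ndij] := boolP (dep Q i j); last first.
    by rewrite !(jacobian_no_dep Qmps Qquad) // addr0 !mul0r.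
  apply: ler_wpM2l; first by rewrite addr_ge0 // jacobian_ge0.
  have [jS|jS] := boolP (j \in S).
    by have [l ->] := enum_val_ex jS; rewrite /y update_in mxE subrr.
  by rewrite /y update_out //; apply: ze dij; rewrite // enum_valP.
have qU := jacobian_row_sum Qmps Qquad i U_ge1 q_ge0 q_le.
have yU := jacobian_row_sum Qmps Qquad i U_ge1 y0 (fun j => le_trans (yq j 0) (q_le j)).
have : 2 * U * eval_sys Q (const_mx 1) i 0 <= 2 * U * A.
  by apply: ler_wpM2l => //; have := U_ge1; lra.
rewrite -mulr_suml big_split /= => UA.
have : \sum_j jacobian Q q i j + \sum_j jacobian Q y i j <= 2 * (2 * U * A).
  by move: qU yU UA; lra.
move=> /(ler_wpM2r e0); by lra.
Qed.

Let cst_least k : 0 < scc_cst Q S q k 0 -> cm * mu ^+ 2 <= scc_cst Q S q k 0.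
Proof.
have /andP[cm0 _] := cm01.
have -> : scc_cst Q S q k 0
    = (Q (enum_val k)).@[fun j => update q (0 : 'cV[R]_#|S|) j 0] by rewrite !mxE.
apply: (meval_least (Qquad _) (ltW cm0) mu01 (Qmps _) (Q_cm (i := _))).
move=> i; apply: (@update_ind _ _ _ (fun _ r => r = 0 \/ mu <= r)) => [l|j _].
  by left; rewrite zeromx_entry.
by right; have := q_mu j; case/andP: mu01; lra.
Qed.

(** The guard e <= mu: as q >= 2 mu, both q/2 on [S] and the computed values that [S] depends on are
    then at least mu, so J1(q/2) has all edges of M with weight at least b. The linear estimate
    compares entries through M alone and has no guard; its factor cm mu^2 bounds positive constants
    from below. *)
Lemma process_scc_ok :
  exists2 z', process_scc Q q h g z S = Some z' &
    [/\ lemx 0 z', lemx z' q, forall i, i \notin S -> z' i 0 = z i 0 &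
    forall e : R, 0 <= e ->
      (forall i j, i \in S -> j \notin S -> dep Q i j -> q j 0 - z j 0 <= e) ->
      forall i, i \in S ->
      if linear_scc Q q S then is_true (
        cm * mu ^+ 2 * b ^+ #|S| * (q i 0 - z' i 0 - 2 ^ (- h))
          <= #|S|%:R * U * (2 * U * A * e))
      else e <= mu -> exists W : R, [/\ 0 <= W,
        cm * b ^+ (3 * #|S|) * W ^+ 2 <= 2 * #|S|%:R * (2 * U * A * e) &
        b ^+ #|S| * (q i 0 - z' i 0 - W) <= U / 2 ^+ g + 2 * 2 ^ (- h)]].
Proof.
have wrap x : lemx 0 x -> lemx x qS -> [/\ lemx 0 (update z x),
    lemx (update z x) q & forall i, i \notin S -> update z x i 0 = z i 0].
  move=> x0 xq; split; [exact: update_ge0| |exact: update_out].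
  by rewrite -[X in lemx _ X](update_restrict S); apply: update_le.
move: cm01 mu01 => /andP[cm0 cm1] /andP[mu0 mu1].
rewrite /process_scc; case: ifPn => lin.
  have [i0 _ SE] := imsetP S_scc.
  have i0S : i0 \in S by rewrite SE inE !connect0.
  have [x -> [x0 xq xb]] := rnm_linear_bound h (@scc_hess_ge0 _ _ _ S Qmps)
    (@scc_hessC _ _ Q S) cst_ge0 cst_le grad_ge0 grad_le qS_gt0 qS_fix scc_least
    (scc_evalE Qquad z) (scc_jacobianE Qquad z) b01 M_irr M_edge
    (linear_scc_hess Qquad lin) (enum_rank_in i0S i0).
  have [? ? ?] := wrap x x0 xq; exists (update z x) => //; split=> // e e0 ze i iS.
  have [l ->] := enum_val_ex iS; rewrite update_in.
  have := xb U (cm * mu ^+ 2) _ qS_le _ cst_least (defect_le e0 ze) l.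
  by rewrite [qS _ _]mxE; apply; rewrite mulr_ge0 ?exprn_ge0 // ltW.
have [k0 [a0 [b0 Hgt]]] := nonlinear_scc_hess Qmps Qquad lin.
have [x -> [x0 xq xb]] := rnm_nonlinear_bound h (@scc_hess_ge0 _ _ _ S Qmps)
    (@scc_hessC _ _ Q S) cst_ge0 cst_le grad_ge0 grad_le qS_gt0 qS_fix scc_least
    (scc_evalE Qquad z) (scc_jacobianE Qquad z) b01 M_irr M_edge Hgt g.
have [? ? ?] := wrap x x0 xq; exists (update z x) => //; split=> // e e0 ze i iS emu.
have [l ->] := enum_val_ex iS; rewrite update_in.
have := xb U cm (2 * U * A * e) qS_le _ _ (defect_le e0 ze) l.
rewrite [qS _ _]mxE; apply.
- move=> k l'; rewrite M_pos_dep scc_qjac // => dkl.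
  apply: (jacobian_edge Qmps Qquad _ _ Q_cm) => //; [exact: ltW|lra| |].
    apply: update_ge0 => // a j; rewrite !entryE mulr_ge0 ?invr_ge0 //.
    by have := qS_ge0 a j; rewrite zeromx_entry.
  move=> j dkj; have [jS|jS] := boolP (j \in S).
    have [a ->] := enum_val_ex jS; rewrite update_in !entryE mxE.
    by have := q_mu (enum_val a); lra.
  rewrite update_out //; have := ze _ _ (enum_valP k) jS dkj.
  by have := q_mu j; lra.
- rewrite ltW //=; move: Hgt; rewrite !mxE; apply: hess0_least; exact: Q_cm.
Qed.

End ProcessScc.

(** * The graph of SCCs *)

(** The depth below [S], counting [S] itself; since [S :: p] has at most n nodes, [p] has fewer than
    n. *)
Definition path_weight (R : realType) n (Q : system R n) (w : pred {set 'I_n})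
    (S : {set 'I_n}) : nat :=
  \max_(k < n) \max_(p : k.-tuple {set 'I_n} | scc_path Q (S :: p))
    count w (S :: p).

Section SccGraph.
Variables (R : realType) (n : nat) (Q : system R n) (ss : seq {set 'I_n}).
Hypothesis ss_bu : bottom_up Q ss.
Implicit Types (S T : {set 'I_n}) (w : pred {set 'I_n}).

Lemma mem_bottom_up S : (S \in ss) = (S \in sccs Q).
Proof. by case/andP: ss_bu => /perm_mem -> _; rewrite mem_enum. Qed.

Lemma bottom_up_uniq : uniq ss.
Proof. by case/andP: ss_bu => /perm_uniq -> _; apply: enum_uniq. Qed.

Lemma scc_refl i : i \in scc Q i.
Proof. by rewrite inE !connect0. Qed.

Lemma scc_in_sccs i : scc Q i \in sccs Q.
Proof. exact: imset_f. Qed.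

Lemma scc_eq T i : T \in sccs Q -> i \in T -> T = scc Q i.
Proof.
move=> /imsetP[j _ ->]; rewrite inE => /andP[ji ij].
apply/setP => k; rewrite !inE; apply/andP/andP => -[h1 h2]; split.
- exact: connect_trans ij h1.
- exact: connect_trans h2 ji.
- exact: connect_trans ji h1.
- exact: connect_trans h2 ij.
Qed.

Lemma scc_edge_dep S i j :
  i \in S -> j \notin S -> dep Q i j -> scc_edge Q S (scc Q j).
Proof.
move=> iS jS ij; apply/andP; split.
  by apply: contraNneq jS => ->; apply: scc_refl.
apply/existsP; exists i; rewrite iS; apply/existsP; exists j.
by rewrite scc_refl.
Qed.

Lemma scc_edge_index S T :
  S \in ss -> T \in ss -> scc_edge Q S T -> (index T ss < index S ss)%N.
Proof.
move=> Sss Tss ST; rewrite ltnNge; apply/negP => le_ST.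
have : (index S ss < index T ss)%N.
  rewrite ltn_neqAle le_ST andbT; apply/eqP => eST.
  move: ST => /andP[/eqP ST _]; apply: ST.
  by rewrite -(nth_index set0 Sss) eST nth_index.
case/andP: ss_bu => _ /(pairwiseP set0) pw lt_ST.
have := pw (index S ss) (index T ss); rewrite !inE !index_mem !nth_index //.
by move=> /(_ Sss Tss lt_ST); rewrite ST.
Qed.

(** Each edge strictly lowers the position in the bottom-up order, so no SCC repeats, and there are
    at most n of them. *)
Lemma scc_path_size p : scc_path Q p -> (size p <= n)%N.
Proof.
case/andP=> /allP pS ep.
have p_ss : {subset p <= ss} by move=> S /pS; rewrite mem_bottom_up.
have up : uniq p.
  pose r : rel {set 'I_n} := fun S T => (index T ss < index S ss)%N.
  apply: (@sorted_uniq _ r).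
  - by move=> S T V TS SV; apply: ltn_trans SV TS.
  - by move=> S; apply: ltnn.
  apply: (sub_in_sorted (P := mem ss)) ep; last by apply/allP.
  by move=> S T Sss Tss; apply: scc_edge_index.
apply: leq_trans (uniq_leq_size up p_ss) _.
case/andP: ss_bu => /perm_size -> _; rewrite -cardE.
by apply: leq_trans (leq_imset_card _ _) _; rewrite card_ord.
Qed.

Lemma path_weight_le_max w S : (path_weight Q w S <= max_count_on_paths Q w)%N.
Proof.
apply/bigmax_leqP => k _; apply/bigmax_leqP => p Sp.
apply: leq_trans (leq_bigmax (Ordinal (ltn_ord k : k.+1 < n.+1)%N)).
exact: (@leq_bigmax_cond _ (fun p : k.+1.-tuple _ => scc_path Q p)
  (fun p => count w p) (cons_tuple S p)).
Qed.

Lemma path_weight_ge w S p :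
  scc_path Q (S :: p) -> (count w (S :: p) <= path_weight Q w S)%N.
Proof.
move=> Sp; have := scc_path_size Sp => /= sp.
apply: leq_trans (leq_bigmax (Ordinal sp)).
exact: (@leq_bigmax_cond _ (fun p : (size p).-tuple _ => scc_path Q (S :: p))
  (fun p => count w (S :: p)) (in_tuple p)).
Qed.

Lemma path_weight_self w S : S \in sccs Q -> (w S <= path_weight Q w S)%N.
Proof.
move=> SQ; have := @path_weight_ge w S [::]; rewrite /= addn0; apply.
by rewrite /scc_path /= SQ.
Qed.

Lemma path_weight_edge w S T : S \in sccs Q -> scc_edge Q S T ->
  (w S + path_weight Q w T <= path_weight Q w S)%N.
Proof.
move=> SQ ST; rewrite -leq_subRL ?path_weight_self //.
apply/bigmax_leqP => k _; apply/bigmax_leqP => p /andP[Tp ep].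
rewrite leq_subRL ?path_weight_self //; apply: (@path_weight_ge w S (T :: p)).
by rewrite /scc_path /= SQ ST; move: Tp ep => /= -> ->.
Qed.

End SccGraph.

(** * Constants and error propagation *)

Section Extrema.
Variable R : realType.
Implicit Types s : seq R.

Lemma seq_min_le s x : x \in s -> seq_min s <= x.
Proof.
rewrite /seq_min; move: (head 0 s) => x0; elim: s => // y s IHs.
by rewrite inE big_cons ge_min => /predU1P[->|/IHs ->]; rewrite ?lexx ?orbT.
Qed.

Lemma seq_max_ge s x : x \in s -> x <= seq_max s.
Proof.
rewrite /seq_max; move: (head 0 s) => x0; elim: s => // y s IHs.
by rewrite inE big_cons le_max => /predU1P[->|/IHs ->]; rewrite ?lexx ?orbT.
Qed.

Lemma seq_min_gt0 s : s != [::] -> (forall x, x \in s -> 0 < x) -> 0 < seq_min s.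
Proof.
case: s => // x0 s _ s_gt0; rewrite /seq_min big_seq.
apply: (big_ind (fun x => 0 < x)) => //; first by rewrite s_gt0 // mem_head.
by move=> x y xp yp; rewrite lt_min xp.
Qed.

Lemma norm_oo_le n (v : 'cV[R]_n) (e : R) :
  0 <= e -> (forall i, `|v i 0| <= e) -> norm_oo v <= e.
Proof.
by move=> e0 ve; apply: (big_ind (fun x => x <= e)) => // x y xe ye; rewrite ge_max xe.
Qed.

Lemma norm_oo_ge n (v : 'cV[R]_n) i : `|v i 0| <= norm_oo v.
Proof. by rewrite /norm_oo (bigD1 i) //= le_max lexx. Qed.

Lemma coord_min_le n (v : 'cV[R]_n) i : coord_min v <= v i 0.
Proof. by apply: seq_min_le; apply/mapP; exists i; rewrite ?mem_enum. Qed.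

Lemma coord_max_ge n (v : 'cV[R]_n) i : v i 0 <= coord_max v.
Proof. by apply: seq_max_ge; apply/mapP; exists i; rewrite ?mem_enum. Qed.

Lemma coord_min_gt0 n (v : 'cV[R]_n) :
  (0 < n)%N -> (forall i, 0 < v i 0) -> 0 < coord_min v.
Proof.
move=> n0 v0; apply: seq_min_gt0 => [|x /mapP[i _ -> //]].
by rewrite -size_eq0 size_map size_enum_ord -lt0n.
Qed.

End Extrema.

Section LeastCoef.
Variables (R : realType) (n : nat) (Q : system R n) (q : 'cV[R]_n).
Hypothesis n_gt0 : (0 < n)%N.
Hypothesis Qmps : is_mps Q.
Hypothesis q_fix : eval_sys Q q = q.
Hypothesis q_gt0 : forall i, 0 < q i 0.

Lemma least_coef_le i m : 0 < (Q i)@_m -> least_coef Q <= (Q i)@_m.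
Proof.
move=> Qm; apply: seq_min_le; rewrite mem_filter Qm /=.
apply/allpairsPdep; exists i, m; split=> //; first by rewrite mem_enum.
by rewrite mcoeff_msupp gt_eqF.
Qed.

Lemma lfp_pos_coef i : exists2 m, m \in msupp (Q i) & 0 < (Q i)@_m.
Proof.
have Qi : Q i != 0.
  apply: contraTneq (q_gt0 i) => Qi.
  by rewrite -q_fix mxE Qi meval0 ltxx.
exists (mlead (Q i)); first exact: mlead_supp.
by rewrite lt_neqAle Qmps andbT eq_sym -mcoeff_msupp mlead_supp.
Qed.

Lemma least_coef_gt0 : 0 < least_coef Q.
Proof.
have [m mQ Qm] := lfp_pos_coef (Ordinal n_gt0).
apply: seq_min_gt0 => [|x]; last by rewrite mem_filter => /andP[].
apply/eqP => pc0; have : (Q (Ordinal n_gt0))@_m \in positive_coefs Q.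
  rewrite mem_filter Qm; apply/allpairsPdep.
  by exists (Ordinal n_gt0), m; rewrite mem_enum.
by rewrite pc0.
Qed.

Lemma least_coef_le_norm : least_coef Q <= norm_oo (eval_sys Q (const_mx 1)).
Proof.
have [m mQ Qm] := lfp_pos_coef (Ordinal n_gt0).
apply: le_trans (norm_oo_ge _ (Ordinal n_gt0)).
apply: le_trans (ler_norm _); apply: le_trans (least_coef_le Qm) _.
rewrite mxE mevalE (bigD1_seq m) //= big1 ?mulr1 => [|k _]; last first.
  by rewrite mxE expr1n.
rewrite lerDl; apply: sumr_ge0 => m' _; rewrite mulr_ge0 //.
by apply: prodr_ge0 => k _; rewrite mxE expr1n.
Qed.

End LeastCoef.

(** * The roots d^(1/2^f) as iterated square roots *)

Section IterSqrt.
Variables (R : realType) (d : R).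
Hypothesis d01 : 0 <= d <= 1.
Let r f := iter f Num.sqrt d.

Lemma iter_sqrt_itv f : 0 <= r f <= 1.
Proof.
elim: f => //= f /andP[r0 r1]; rewrite sqrtr_ge0 /=.
by rewrite -[leRHS]sqrtr1; apply: ler_wsqrtr.
Qed.

Lemma iter_sqrt_sqr f : r f.+1 ^+ 2 = r f.
Proof. by rewrite /r /= sqr_sqrtr //; case/andP: (iter_sqrt_itv f). Qed.

Lemma iter_sqrt_le f f' : (f <= f')%N -> r f <= r f'.
Proof.
move=> /subnK <-; elim: (f' - f)%N => [|k IHk]; first by rewrite add0n.
apply: le_trans IHk _; rewrite addSn -iter_sqrt_sqr expr2.
by have /andP[r0 r1] := iter_sqrt_itv (k + f).+1; apply: ler_piMr.
Qed.

Lemma iter_sqrt_expn f : r f ^+ (2 ^ f) = d.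
Proof.
elim: f => [|f IHf]; first by rewrite expn0 expr1.
by rewrite expnS exprM iter_sqrt_sqr.
Qed.

End IterSqrt.

(** * Absorbing all constants into K *)

Section Arithmetic.
Variables (R : realType) (n : nat) (U cm mu A : R).
Hypothesis n_gt0 : (0 < n)%N.
Hypothesis U_ge1 : 1 <= U.
Hypothesis cm01 : 0 < cm <= 1.
Hypothesis mu01 : 0 < mu <= 1.
Hypothesis cm_le : cm <= A.

Definition alpha_of : R := (U ^+ 2)^-1 * cm * mu.
(** With U = 2^u and A the norm of Q(1), log K is exactly the bracket multiplied by d in g'. *)
Definition growth : R := U ^+ 2 * alpha_of ^- (4 * n + 1) * (16 * n%:R) * A.

Let a := alpha_of.
Let K := growth.
Let b := cm * mu.

Let cm_gt0 : 0 < cm. Proof. by case/andP: cm01. Qed.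
Let mu_gt0 : 0 < mu. Proof. by case/andP: mu01. Qed.
Let U_gt0 : 0 < U. Proof. exact: lt_le_trans U_ge1. Qed.
Let U2_ge1 : 1 <= U ^+ 2. Proof. exact: exprn_ege1. Qed.
Let A_gt0 : 0 < A. Proof. exact: lt_le_trans cm_le. Qed.
Let n1 : 1 <= n%:R :> R. Proof. by rewrite ler1n. Qed.
Let b_gt0 : 0 < b. Proof. exact: mulr_gt0. Qed.

Let cm_ge0 : 0 <= cm. Proof. exact: ltW. Qed.
Let mu_ge0 : 0 <= mu. Proof. exact: ltW. Qed.
Let U_ge0 : 0 <= U. Proof. exact: ltW. Qed.
Let A_ge0 : 0 <= A. Proof. exact: ltW. Qed.
Let b_ge0 : 0 <= b. Proof. exact: ltW. Qed.

Let b_le1 : b <= 1.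
Proof. by move: cm01 mu01 => /andP[? ?] /andP[? ?]; rewrite mulr_ile1 // ltW. Qed.

Let a_le_b : a <= b.
Proof.
rewrite /a /alpha_of -mulrA; apply: ler_piMl; first exact: ltW.
by rewrite invf_le1 // exprn_gt0.
Qed.

Lemma alpha_of_gt0 : 0 < a.
Proof. by rewrite /a /alpha_of -mulrA mulr_gt0 // invr_gt0 exprn_gt0. Qed.

Let a_ge0 : 0 <= a. Proof. exact: ltW alpha_of_gt0. Qed.

Let growth_alpha : K * a ^+ (4 * n + 1) = 16 * n%:R * U ^+ 2 * A.
Proof.
have : a ^+ (4 * n + 1) != 0 by rewrite expf_neq0 // gt_eqF // alpha_of_gt0.
by rewrite /K /growth -/a; move: (a ^+ _) => y y0; field.
Qed.

(** One of the 4 n + 1 factors alpha is spent on A, since alpha <= cm <= A. *)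
Let growth_ge : 16 * U ^+ 2 <= K * a ^+ (4 * n).
Proof.
rewrite -(ler_pM2r alpha_of_gt0).
have -> : K * a ^+ (4 * n) * a = K * a ^+ (4 * n + 1) by rewrite addn1 exprSr mulrA.
rewrite growth_alpha.
have aA : a <= A.
  apply: le_trans cm_le; apply: le_trans a_le_b _.
  by apply: ler_piMr; [apply: ltW|case/andP: mu01].
apply: (@le_trans _ _ (16 * U ^+ 2 * A)).
  by apply: ler_wpM2l => //; rewrite mulr_ge0 // exprn_ge0 //.
have UA0 : 0 <= U ^+ 2 * A by rewrite mulr_ge0 // exprn_ge0.
by have := ler_wpM2r UA0 n1; lra.
Qed.

Lemma growth_gt0 : 0 < K.
Proof.
rewrite -(pmulr_lgt0 _ (exprn_gt0 (4 * n) alpha_of_gt0)).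
by apply: lt_le_trans growth_ge; rewrite mulr_gt0 // exprn_gt0.
Qed.

Let K_ge0 : 0 <= K. Proof. exact: ltW growth_gt0. Qed.

Let a_exp_le m m' : (m <= m')%N -> a ^+ m' <= b ^+ m.
Proof.
move=> mm; apply: (@le_trans _ _ (b ^+ m')).
  by apply: lerXn2r; rewrite ?nnegrE //.
by apply: ler_wiXn2l.
Qed.

Let growth_ge_b m : (m <= 4 * n)%N -> 16 * U ^+ 2 <= K * b ^+ m.
Proof.
move=> mn; apply: le_trans growth_ge _.
by apply: ler_wpM2l; [apply: ltW growth_gt0|apply: a_exp_le].
Qed.

Let U_leU2 : U <= U ^+ 2.
Proof. by rewrite expr2; apply: ler_peMr. Qed.

Lemma growth_ge1 : 1 <= K.
Proof. by have := @growth_ge_b 0 isT; rewrite expr0 mulr1; have := U2_ge1; lra. Qed.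

Lemma growth_geU : 16 * U <= K.
Proof. by have := @growth_ge_b 0 isT; rewrite expr0 mulr1; have := U_leU2; lra. Qed.

Lemma growth_mu : U <= K * mu.
Proof.
have n4 : (1 <= 4 * n)%N by rewrite muln_gt0.
have := growth_ge_b n4; rewrite expr1 => KU.
apply: (@le_trans _ _ (16 * U ^+ 2)); first by have := U_leU2; have := U_gt0; lra.
apply: le_trans KU _; apply: ler_wpM2l; first exact: ltW growth_gt0.
by apply: ler_piMl; [apply: ltW|case/andP: cm01].
Qed.

Let cancel_alpha m (t y : R) : (m <= 4 * n + 1)%N -> 0 <= y -> b ^+ m * t <= y ->
  a ^+ (4 * n + 1) * t <= y.
Proof.
move=> mn y0 bt; have [t0|t0] := leP 0 t.
  by apply: le_trans bt; apply: ler_wpM2r => //; apply: a_exp_le.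
apply: le_trans y0; rewrite pmulr_rle0; first exact: ltW.
by rewrite exprn_gt0 // alpha_of_gt0.
Qed.

(** Here cm mu^2 b^m >= b^(m+2), and m + 2 <= 4 n + 1. The term U dl / 2 is the rounding error; the
    constants 2 n against 16 n leave K e / 8 for the rest. *)
Lemma linear_error m (e dl x : R) : (m <= n)%N -> 0 <= dl -> dl <= e ->
  cm * mu ^+ 2 * b ^+ m * (x - U * dl / 2) <= m%:R * U * (2 * U * A * e) ->
  x <= K * e.
Proof.
move=> mn dl0 dle xle; have e0 : 0 <= e by lra.
have Ue : U * dl <= K * e.
  by apply: ler_pM => //; have := growth_geU; have := U_gt0; lra.
have [T0|T0] := leP (x - U * dl / 2) 0; first by have := mulr_ge0 U_ge0 dl0; lra.
have Ke0 : 0 <= K * e by apply: mulr_ge0.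
have bT : b ^+ m.+2 * (x - U * dl / 2) <= 2 * n%:R * U ^+ 2 * A * e.
  apply: (@le_trans _ _ (m%:R * U * (2 * U * A * e))).
    apply: le_trans xle; apply: ler_wpM2r; first exact: ltW.
    have -> : b ^+ m.+2 = cm * cm * (mu ^+ 2 * b ^+ m).
      by rewrite -addn2 exprD; move: (b ^+ m) => y; rewrite /b; ring.
    rewrite -[leRHS]mulrA; apply: ler_wpM2r.
      by rewrite mulr_ge0 // exprn_ge0 //.
    by apply: ler_piMr; [apply: ltW|case/andP: cm01].
  have -> : m%:R * U * (2 * U * A * e) = m%:R * (2 * U ^+ 2 * A * e) by ring.
  have -> : 2 * n%:R * U ^+ 2 * A * e = n%:R * (2 * U ^+ 2 * A * e) by ring.
  by apply: ler_wpM2r; rewrite ?ler_nat // !mulr_ge0 // ?exprn_ge0 //.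
have mn4 : (m.+2 <= 4 * n + 1)%N.
  by rewrite addn1 ltnS; apply: leq_ltn_trans mn _; apply: ltn_Pmull.
have : a ^+ (4 * n + 1) * (x - U * dl / 2) <= a ^+ (4 * n + 1) * (K * e / 8).
  apply: (cancel_alpha mn4); last first.
    have -> : a ^+ (4 * n + 1) * (K * e / 8) = (K * a ^+ (4 * n + 1)) * e / 8 by ring.
    by rewrite growth_alpha; apply: le_trans bT _; lra.
  by rewrite mulr_ge0 // ?exprn_ge0 ?divr_ge0 //.
rewrite ler_pM2l; last by rewrite exprn_gt0 // alpha_of_gt0.
by have := mulr_ge0 U_ge0 dl0; lra.
Qed.

(** Each of W and x - W gets half of the bound. The exponent 3 m + 1 <= 4 n + 1 gives W^2 <= K e /
    4, which is at most the square of K^(d+1) r / 2 because K^(d+1) >= 1. The Newton and rounding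
    errors together are 2 U dl, absorbed by 16 U^2 <= K b^m. *)
Lemma nonlinear_error m (d : nat) (r r' dl W x : R) : (m <= n)%N ->
  0 <= dl -> dl <= r -> 0 <= r -> r ^+ 2 = r' -> 0 <= W ->
  cm * b ^+ (3 * m) * W ^+ 2 <= 2 * m%:R * (2 * U * A * (K ^+ d * r')) ->
  b ^+ m * (x - W) <= U * dl + 2 * (U * dl / 2) ->
  x <= K ^+ d.+1 * r.
Proof.
move=> mn dl0 dlr r0 r2 W0 Wle xle.
have K0 := growth_gt0; have K1 := growth_ge1.
have Kd1 : 1 <= K ^+ d by rewrite exprn_ege1.
have r'0 : 0 <= r' by rewrite -r2 exprn_ge0.
pose e := K ^+ d * r'; have e0 : 0 <= e by rewrite mulr_ge0 // exprn_ge0 //.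
have W_le : W <= 2^-1 * (K ^+ d.+1 * r).
  have W2 : W ^+ 2 <= K * e / 4.
    have bW : b ^+ (3 * m + 1) * W ^+ 2 <= 4 * n%:R * U ^+ 2 * A * e.
      apply: (@le_trans _ _ (cm * b ^+ (3 * m) * W ^+ 2)).
        apply: ler_wpM2r; first exact: exprn_ge0.
        rewrite addn1 exprS; apply: ler_wpM2r; first by rewrite exprn_ge0 //.
        by apply: ler_piMr; [apply: ltW|case/andP: mu01].
      apply: le_trans Wle _; rewrite -/e.
      have -> : 2 * m%:R * (2 * U * A * e) = m%:R * U * (4 * A * e) by ring.
      have -> : 4 * n%:R * U ^+ 2 * A * e = n%:R * U ^+ 2 * (4 * A * e) by ring.
      apply: ler_wpM2r; first by apply: mulr_ge0 => //; apply: mulr_ge0.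
      apply: ler_pM; [exact: ler0n|exact: U_ge0| |exact: U_leU2].
      by rewrite ler_nat.
    have mn4 : (3 * m + 1 <= 4 * n + 1)%N by rewrite leq_add2r leq_mul.
    have : a ^+ (4 * n + 1) * W ^+ 2 <= a ^+ (4 * n + 1) * (K * e / 4).
      apply: (cancel_alpha mn4); last first.
        have -> : a ^+ (4 * n + 1) * (K * e / 4) = (K * a ^+ (4 * n + 1)) * e / 4 by ring.
        by rewrite growth_alpha; apply: le_trans bW _; lra.
      by apply: mulr_ge0; [apply: exprn_ge0|apply: divr_ge0 => //; apply: mulr_ge0].
    by rewrite ler_pM2l // exprn_gt0 // alpha_of_gt0.
  rewrite -(@ler_pXn2r _ 2) ?nnegrE //; last first.
    by rewrite !mulr_ge0 ?invr_ge0 ?exprn_ge0 //.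
  apply: le_trans W2 _.
  have -> : (2^-1 * (K ^+ d.+1 * r)) ^+ 2 = K * e / 4 * (K * K ^+ d).
    by rewrite /e -r2 [K ^+ d.+1]exprS; move: (K ^+ d) => y; field.
  apply: ler_peMr; first by apply: divr_ge0 => //; apply: mulr_ge0.
  by rewrite mulr_ege1.
have x_le : x - W <= 2^-1 * (K ^+ d.+1 * r).
  have bm0 : 0 < b ^+ m by rewrite exprn_gt0.
  rewrite -(ler_pM2l bm0); apply: le_trans xle _.
  have mn4 : (m <= 4 * n)%N by rewrite (leq_trans mn) // leq_pmull.
  have Kb := growth_ge_b mn4; have UU := U_leU2.
  have : (2 * U) * dl <= (2^-1 * (K * b ^+ m)) * (K ^+ d * r).
    apply: ler_pM => //; [by rewrite mulr_ge0|by have := U_gt0; lra|].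
    by apply: le_trans dlr _; apply: ler_peMl.
  by rewrite [K ^+ d.+1]exprS; lra.
lra.
Qed.

End Arithmetic.

(** * Error propagation along the DAG of SCCs *)

Section DecomposedNewton.
Variables (R : realType) (n : nat) (Q : system R n) (q : 'cV[R]_n).
Variables (ss : seq {set 'I_n}) (U cm mu A dl : R) (h : int) (g : nat).
Variable small : Prop.
Hypothesis n_gt0 : (0 < n)%N.
Hypothesis Qmps : is_mps Q.
Hypothesis Qquad : quadratic Q.
Hypothesis q_lfp : is_lfp Q q.
Hypothesis q_gt0 : forall i, 0 < q i 0.
Hypothesis ss_bu : bottom_up Q ss.
Hypothesis U_ge1 : 1 <= U.
Hypothesis q_le : forall i, q i 0 <= U.
Hypothesis cm01 : 0 < cm <= 1.
Hypothesis Q_cm : forall i m, 0 < (Q i)@_m -> cm <= (Q i)@_m.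
Hypothesis mu01 : 0 < mu <= 1.
Hypothesis q_mu : forall i, 2 * mu <= q i 0.
Hypothesis Q1_le : forall i, eval_sys Q (const_mx 1) i 0 <= A.
Hypothesis cm_le : cm <= A.
Hypothesis dl01 : 0 <= dl <= 1.
Hypothesis small_h : small -> 2 ^ (- h) = U * dl / 2.
Hypothesis small_g : small -> U / 2 ^+ g = U * dl.

Let K := growth n U cm mu A.
Let nl : pred {set 'I_n} := fun S => ~~ linear_scc Q q S.
Let r f := iter f Num.sqrt dl.
Let bound S := K ^+ path_weight Q predT S * r (path_weight Q nl S).

Let K_ge1 : 1 <= K.
Proof. exact: growth_ge1. Qed.

Let K_ge0 : 0 <= K.
Proof. exact: le_trans K_ge1. Qed.

Let r_ge0 f : 0 <= r f.
Proof. by case/andP: (iter_sqrt_itv dl01 f). Qed.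

Let r_ge f : dl <= r f.
Proof. exact: (iter_sqrt_le dl01 (leq0n f)). Qed.

Let bound_le d d' f f' : (d <= d')%N -> (f <= f')%N ->
  K ^+ d * r f <= K ^+ d' * r f'.
Proof.
move=> dd ff; apply: ler_pM => //; first exact: exprn_ge0.
  exact: ler_weXn2l.
exact: (iter_sqrt_le dl01 ff).
Qed.

(** [e] bounds the errors of all SCCs that [S] depends on: their depth is smaller by at least one,
    their nonlinear depth by at least one if [S] is nonlinear. *)
Let process_error S (z' : 'cV[R]_n) e i :
  S \in sccs Q -> lemx 0 z' -> small ->
  e = K ^+ (path_weight Q predT S).-1 * r (path_weight Q nl S - nl S) ->
  i \in S ->
  (if linear_scc Q q S then is_true (
     cm * mu ^+ 2 * (cm * mu) ^+ #|S| * (q i 0 - z' i 0 - 2 ^ (- h))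
       <= #|S|%:R * U * (2 * U * A * e))
   else e <= mu -> exists W : R, [/\ 0 <= W,
     cm * (cm * mu) ^+ (3 * #|S|) * W ^+ 2 <= 2 * #|S|%:R * (2 * U * A * e) &
     (cm * mu) ^+ #|S| * (q i 0 - z' i 0 - W) <= U / 2 ^+ g + 2 * 2 ^ (- h)]) ->
  q i 0 - z' i 0 <= bound S.
Proof.
move=> SQ z'0 sm eE iS.
have Sn : (#|S| <= n)%N by rewrite -[X in (_ <= X)%N]card_ord max_card.
have /andP[dl0 _] := dl01.
have dE : path_weight Q predT S = (path_weight Q predT S).-1.+1.
  by rewrite prednK //; have := path_weight_self ss_bu predT SQ.
rewrite small_h // small_g //; case: ifPn => lin.
  have fE : (path_weight Q nl S - nl S)%N = path_weight Q nl S.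
    by rewrite /nl lin subn0.
  rewrite fE in eE; have dle : dl <= e.
    by rewrite eE; apply: le_trans (r_ge _) _; apply: ler_peMl => //; apply: exprn_ege1.
  move=> /(linear_error n_gt0 U_ge1 cm01 mu01 cm_le Sn dl0 dle) /le_trans; apply.
  by rewrite eE /bound mulrA -exprS -dE.
have fE : path_weight Q nl S = (path_weight Q nl S - nl S).+1.
  have := path_weight_self ss_bu nl SQ; rewrite /nl lin /= => f1.
  by rewrite subn1 prednK.
have [emu|emu] := leP e mu => [/(_ isT) [W [W0 W2 xW]]|_].
  rewrite eE in W2; rewrite /bound dE fE.
  apply: (nonlinear_error n_gt0 U_ge1 cm01 mu01 cm_le Sn dl0 _ _ _ W0 W2 xW) => //.
  exact: (iter_sqrt_sqr dl01).
(* If e > mu, nothing is known about the iteration, but the error is at most U <= K mu <= K e. *)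
apply: (@le_trans _ _ U).
  by apply: le_trans (q_le i); rewrite gerBl; have := z'0 i 0; rewrite zeromx_entry.
apply: le_trans (growth_mu n_gt0 U_ge1 cm01 mu01 cm_le) _.
apply: (@le_trans _ _ (K * e)); first by apply: ler_wpM2l => //; apply: ltW.
rewrite eE mulrA -exprS -dE; apply: bound_le => //.
exact: leq_subr.
Qed.

(** [small] will be g' >= 0. For negative g' the iteration count is 0 and no longer matches h', so
    only existence and 0 <= z <= q are asserted then. *)
Lemma rdnm_bound : exists2 z, rdnm Q q h g ss = Some z &
  [/\ lemx 0 z, lemx z q &
      small -> forall i,
        q i 0 - z i 0 <= growth n U cm mu A ^+ depth Q
                         * iter (nonlinear_depth Q q) Num.sqrt dl].
Proof.
have prefix ss1 ss2 : ss = ss1 ++ ss2 ->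
    exists2 z, rdnm Q q h g ss1 = Some z & [/\ lemx 0 z, lemx z q &
      small -> forall T, T \in ss1 -> forall i, i \in T ->
        q i 0 - z i 0 <= bound T].
  elim/last_ind: ss1 ss2 => [|ss1 S IHs] ss2 ssE.
    exists 0 => //; split=> //.
    by move=> i j; rewrite zeromx_entry (ord1 j) ltW.
  rewrite cat_rcons in ssE; have [z zE [z0 zq zb]] := IHs _ ssE.
  have Sss : S \in ss by rewrite ssE mem_cat mem_head orbT.
  have SQ : S \in sccs Q by rewrite -(mem_bottom_up ss_bu).
  have [z' z'E [z'0 z'q z'out z'b]] := process_scc_ok Qmps Qquad q_lfp q_gt0
    U_ge1 q_le cm01 Q_cm mu01 q_mu Q1_le h g SQ z0 zq.
  exists z'; first by rewrite /rdnm foldl_rcons -/(rdnm _ _ _ _ _) zE.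
  split=> // sm T; rewrite mem_rcons inE => /predU1P[->|Tss1] i iT; last first.
    rewrite z'out; first exact: zb.
    apply/negP => iS; have TQ : T \in sccs Q.
      by rewrite -(mem_bottom_up ss_bu) ssE mem_cat Tss1.
    have TS : T = S by rewrite (scc_eq TQ iT) (scc_eq SQ iS).
    have := bottom_up_uniq ss_bu; rewrite ssE cat_uniq => /and3P[_ /hasPn/(_ S)].
    by rewrite mem_head /= -TS Tss1 => /(_ isT).
  pose e := K ^+ (path_weight Q predT S).-1 * r (path_weight Q nl S - nl S).
  apply: (process_error SQ z'0 sm (erefl e) iT).
  apply: z'b => //; first by rewrite mulr_ge0 // exprn_ge0.
  move=> a j aS jS aj; have ST := scc_edge_dep aS jS aj.
  have Tss : scc Q j \in ss by rewrite (mem_bottom_up ss_bu) scc_in_sccs.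
  (* The SCC of j is not [S] because j lies outside [S], and it does not come later because the
     order is bottom-up. *)
  have Tss1 : scc Q j \in ss1.
    move: Tss; rewrite {1}ssE mem_cat inE => /or3P[//|/eqP jE|jss2].
      by move: jS; rewrite -jE scc_refl.
    have /andP[_] := ss_bu; rewrite ssE pairwise_cat /= => /and3P[_ _ /andP[]].
    by move=> /allP/(_ _ jss2); rewrite ST.
  apply: le_trans (zb sm _ Tss1 _ (scc_refl Q j)) _.
  have d1 := path_weight_edge ss_bu predT SQ ST.
  have f1 := path_weight_edge ss_bu nl SQ ST.
  apply: bound_le; first by rewrite -ltnS (leq_trans _ (leqSpred _)).
  by rewrite leq_subRL // (leq_trans _ f1) // leq_addr.
have [z zE [z0 zq zb]] := prefix ss [::] (esym (cats0 ss)).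
exists z => //; split=> // sm i.
have iss : scc Q i \in ss by rewrite (mem_bottom_up ss_bu) scc_in_sccs.
apply: le_trans (zb sm _ iss _ (scc_refl Q i)) _.
by apply: bound_le; apply: path_weight_le_max.
Qed.

End DecomposedNewton.

(** * The parameters u', alpha', g' and h' in terms of K *)

Section ParamBounds.
Variables (R : realType) (n : nat) (Q : system R n) (q : 'cV[R]_n) (eps : R).
Hypothesis n_gt0 : (0 < n)%N.
Hypothesis q_gt0 : forall i, 0 < q i 0.
Hypothesis eps_gt0 : 0 < eps.

Let ln2_gt0 : 0 < exp.ln 2 :> R.
Proof. by apply: exp.ln_gt0; rewrite ltr1n. Qed.

Lemma log2_ln (x : R) : log2 x * exp.ln 2 = exp.ln x.
Proof. by rewrite /log2 divfK // gt_eqF. Qed.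

Lemma u_paramP : exists2 k : nat, u_param q = k & forall i, q i 0 <= 2 ^+ k.
Proof.
have : 0 <= u_param q by rewrite /u_param le_max lexx.
case uE : (u_param q) => [k|//] _; exists k => // i.
have cm_gt0 : 0 < coord_max q.
  exact: lt_le_trans (q_gt0 i) (coord_max_ge q i).
apply: le_trans (coord_max_ge q i) _.
rewrite -exp.ler_ln ?posrE ?exprn_gt0 // exp.lnXn // -log2_ln.
rewrite -[_ *+ k]mulr_natl.
rewrite ler_pM2r //; apply: le_trans (ceil_ge _) _.
have -> : k%:R = (Posz k)%:~R :> R by [].
by rewrite ler_int -uE /u_param le_max lexx orbT.
Qed.

Variables (k : nat) (U cm mu A : R).
Hypothesis uE : u_param q = k.
Hypothesis UE : U = 2 ^+ k.
Hypothesis cmE : cm = Num.min 1 (least_coef Q).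
Hypothesis muE : mu = Num.min 1 (2^-1 * coord_min q).
Hypothesis AE : A = norm_oo (eval_sys Q (const_mx 1)).
Hypothesis cm01 : 0 < cm <= 1.
Hypothesis mu01 : 0 < mu <= 1.
Hypothesis cm_le : cm <= A.

Lemma alpha_paramE : alpha_param Q q = alpha_of U cm mu.
Proof.
rewrite /alpha_param /alpha_of uE -cmE -muE; congr (_ * _ * _).
rewrite UE -exprM exprnN; congr (_ ^ (- _)).
by rewrite mulnC PoszM.
Qed.

Let K := growth n U cm mu A.

(** The definition of g' in multiplicative form: (K^d / eps)^(2^f) <= 2^(g' - 2), with logarithms to
    base 2 turned natural by the factor ln 2. *)
Lemma g_param_ln :
  exp.ln ((K ^+ depth Q / eps) ^+ (2 ^ nonlinear_depth Q q))
    <= (g_param Q q eps - 2)%:~R * exp.ln 2.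
Proof.
have U_ge1 : 1 <= U by rewrite UE exprn_ege1 // ler1n.
have U_gt0 : 0 < U by apply: lt_le_trans U_ge1.
have A_gt0 : 0 < A by apply: lt_le_trans cm_le; case/andP: cm01.
have al_gt0 : 0 < alpha_of U cm mu by apply: alpha_of_gt0.
have al'_gt0 : 0 < alpha_of U cm mu ^- (4 * n + 1) by rewrite invr_gt0 exprn_gt0.
have n16 : 0 < 16 * n%:R :> R by rewrite mulr_gt0 // ltr0n.
have U2_gt0 : 0 < U ^+ 2 by rewrite exprn_gt0.
have K_gt0 : 0 < K by apply: growth_gt0.
have lnK : exp.ln K = 2 * k%:R * exp.ln 2 + exp.ln (alpha_of U cm mu ^- (4 * n + 1))
    + exp.ln (16 * n%:R) + exp.ln A.
  have p1 := mulr_gt0 U2_gt0 al'_gt0; have p2 := mulr_gt0 p1 n16.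
  rewrite /K /growth (@exp.lnM _ _ A) ?posrE //.
  rewrite (@exp.lnM _ _ (16 * n%:R)) ?posrE //.
  rewrite (@exp.lnM _ (U ^+ 2)) ?posrE //; congr (_ + _ + _ + _).
  by rewrite UE -exprM exp.lnXn // -[_ *+ (k * 2)]mulr_natl natrM [k%:R * _]mulrC.
rewrite exp.lnXn ?divr_gt0 ?exprn_gt0 // exp.ln_div ?posrE ?exprn_gt0 //.
rewrite exp.lnXn // /g_param addrAC subrr add0r.
rewrite -[_ *+ (2 ^ _)]mulr_natl natrX.
set X := 2 ^+ _ * (log2 _ + _).
apply: (@le_trans _ _ (X * exp.ln 2)); last first.
  by rewrite ler_pM2r // ceil_ge.
rewrite /X uE alpha_paramE -AE -mulrA; apply: ler_wpM2l; first exact: exprn_ge0.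
have distr (x1 x2 x3 x4 : R) : (x1 + log2 x2 + log2 x3 + log2 x4) * exp.ln 2
    = x1 * exp.ln 2 + exp.ln x2 + exp.ln x3 + exp.ln x4.
  by rewrite !mulrDl !log2_ln.
rewrite mulrDl log2_ln -mulrA distr div1r exp.lnV ?posrE // lnK.
by rewrite -[_ *+ depth Q]mulr_natl addrC.
Qed.

(** For g' <= 0 the power (K^d / eps)^(2^f) cannot exceed 1, so eps is so large that no accuracy is
    required. *)
Lemma g_param_nonpos : g_param Q q eps <= 0 -> K ^+ depth Q <= eps.
Proof.
move=> g0; rewrite -[leRHS]mul1r -ler_pdivrMr // leNgt; apply/negP => K1.
have : 0 < exp.ln ((K ^+ depth Q / eps) ^+ (2 ^ nonlinear_depth Q q)).
  by apply: exp.ln_gt0; rewrite expr_gt1 ?expn_gt0 // ltW // (lt_trans ltr01).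
move=> /lt_le_trans/(_ g_param_ln); rewrite pmulr_lgt0 // ltr0z subr_gt0.
by move=> /lt_le_trans/(_ g0).
Qed.

(** Raising the bound divided by eps to the power 2^f undoes the square roots and gives (K^d /
    eps)^(2^f) / 2^g <= 1. *)
Lemma g_param_pos (g : nat) : g_param Q q eps = g ->
  K ^+ depth Q * iter (nonlinear_depth Q q) Num.sqrt (2 ^+ g)^-1 <= eps.
Proof.
move=> gE; set dl := (2 ^+ g)^-1.
have U_ge1 : 1 <= U by rewrite UE exprn_ege1 // ler1n.
have K_gt0 : 0 < K by apply: growth_gt0.
have dl01 : 0 <= dl <= 1.
  by rewrite invr_ge0 exprn_ge0 //= invf_le1 ?exprn_gt0 // exprn_ege1 // ler1n.
have := g_param_ln; set Y := _ ^+ (2 ^ _) => lnY.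
have Y_gt0 : 0 < Y by rewrite exprn_gt0 // divr_gt0 // exprn_gt0.
have Yle : Y <= 2 ^+ g.
  have g2_gt0 : 0 < 2 ^+ g :> R by rewrite exprn_gt0.
  rewrite -exp.ler_ln ?posrE // [leRHS]exp.lnXn //; apply: le_trans lnY _.
  rewrite -[_ *+ g]mulr_natl ler_pM2r // gE.
  have -> : g%:R = (Posz g)%:~R :> R by [].
  by rewrite ler_int gerBl.
rewrite -[leRHS]mul1r -ler_pdivrMr // mulrAC.
set x := _ * iter _ _ _.
have x0 : 0 <= x.
  apply: mulr_ge0; last by case/andP: (iter_sqrt_itv dl01 (nonlinear_depth Q q)).
  by apply: divr_ge0; [apply: exprn_ge0; apply: ltW|apply: ltW].
rewrite -(@expr_le1 _ (2 ^ nonlinear_depth Q q)) ?expn_gt0 //.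
by rewrite exprMn (iter_sqrt_expn dl01) -/Y ler_pdivrMr ?exprn_gt0 // mul1r.
Qed.

(** Hence the geometric sum 2 2^-h of all rounding errors equals U 2^-g, the Newton error after g
    halvings. *)
Lemma h_paramE (g : nat) : g_param Q q eps = g ->
  2 ^ (- h_param Q q eps) = U * (2 ^+ g)^-1 / 2.
Proof.
move=> gE; rewrite /h_param gE uE opprB opprD addrA !expfzDr ?pnatr_eq0 //.
by rewrite -exprnP -UE -exprnN.
Qed.

End ParamBounds.

Theorem theorem4 (R : realType) (n : nat) (Q : system R n) (qstar : 'cV[R]_n)
    (eps : R) (ss : seq {set 'I_n}) :
  (0 < n)%N ->
  is_mps Q ->
  quadratic Q ->
  is_lfp Q qstar ->
  (forall i, 0 < qstar i 0) ->
  0 < eps ->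
  bottom_up Q ss ->
  exists2 qt : 'cV[R]_n,
    rdnm Q qstar (h_param Q qstar eps) (g_iter Q qstar eps) ss = Some qt
    & norm_oo (qstar - qt) <= eps.
Proof.
move=> n_gt0 Qmps Qquad q_lfp q_gt0 eps_gt0 ss_bu.
have [_ q_fix _] := q_lfp.
have [k uE qU] := u_paramP q_gt0.
pose U : R := 2 ^+ k; pose cm := Num.min 1 (least_coef Q).
pose mu := Num.min 1 (2^-1 * coord_min qstar).
pose A := norm_oo (eval_sys Q (const_mx 1)).
have lc_gt0 := least_coef_gt0 n_gt0 Qmps q_fix q_gt0.
have cm01 : 0 < cm <= 1 by rewrite lt_min ltr01 lc_gt0 ge_min lexx.
have mu01 : 0 < mu <= 1.
  rewrite lt_min ltr01 ge_min lexx andbT mulr_gt0 ?invr_gt0 //.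
  exact: coord_min_gt0.
have cm_lc : cm <= least_coef Q by rewrite ge_min lexx orbT.
have cm_le : cm <= A.
  by apply: le_trans cm_lc _; apply: least_coef_le_norm q_fix q_gt0.
have U_ge1 : 1 <= U by rewrite exprn_ege1 // ler1n.
have Q_cm i m : 0 < (Q i)@_m -> cm <= (Q i)@_m.
  by move=> Qm; apply: le_trans cm_lc _; apply: least_coef_le.
have q_mu i : 2 * mu <= qstar i 0.
  apply: le_trans (coord_min_le qstar i).
  by rewrite mulrC -ler_pdivlMr // mulrC ge_min lexx orbT.
have Q1_le i : eval_sys Q (const_mx 1) i 0 <= A.
  exact: le_trans (ler_norm _) (norm_oo_ge _ i).
set h := h_param Q qstar eps; set g := g_iter Q qstar eps.
pose dl : R := (2 ^+ g)^-1.
have dl01 : 0 <= dl <= 1.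
  by rewrite invr_ge0 exprn_ge0 //= invf_le1 ?exprn_gt0 // exprn_ege1 // ler1n.
have gE : 0 <= g_param Q qstar eps -> g_param Q qstar eps = g.
  by move=> g0; rewrite /g /g_iter max_r // gez0_abs.
have [z zE [z0 zq zb]] := rdnm_bound (small := 0 <= g_param Q qstar eps)
  n_gt0 Qmps Qquad q_lfp q_gt0 ss_bu U_ge1 qU cm01 Q_cm mu01 q_mu Q1_le cm_le
  dl01 (fun g0 => h_paramE uE erefl (gE g0)) (fun _ => erefl).
exists z => //; apply: norm_oo_le; first exact: ltW.
move=> i; rewrite !entryE ger0_norm; last by rewrite subr_ge0; apply: zq.
have [g0|g0] := leP 0 (g_param Q qstar eps).
  apply: le_trans (zb g0 i) _.
  by apply: (g_param_pos n_gt0 eps_gt0 uE) (gE g0).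
(* For g' < 0 only z >= 0 is used: the error is at most U <= K <= K^d <= eps, where d >= 1 because
   the SCC of i is a path. *)
have z_le : qstar i 0 - z i 0 <= U.
  by apply: le_trans (qU i); rewrite gerBl; have := z0 i 0; rewrite zeromx_entry.
apply: le_trans z_le _.
apply: le_trans
  (g_param_nonpos n_gt0 eps_gt0 uE erefl erefl erefl erefl _ _ _ (ltW g0)) => //.
have K1 := growth_ge1 n_gt0 U_ge1 cm01 mu01 cm_le.
have d0 : (0 < depth Q)%N.
  have := path_weight_self ss_bu predT (scc_in_sccs Q i) => /leq_trans; apply.
  exact: path_weight_le_max.
apply: (@le_trans _ _ (growth n U cm mu A)).
  by apply: le_trans (growth_geU n_gt0 U_ge1 cm01 mu01 cm_le); lra.
by rewrite -[leLHS]expr1; apply: ler_weXn2l.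
Qed.
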